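(* Let $\mathcal{G}$ be a minor-closed graph class and let $k\ge 3$. Suppose the $k$-dimensional Weisfeiler–Leman algorithm correctly determines orbits on all arc-colored $3$-connected graphs in $\mathcal{G}$. Then the $k$-dimensional Weisfeiler–Leman algorithm distinguishes every two non-isomorphic graphs in $\mathcal{G}$.
   Context: Graphs are finite, simple and undirected; uncolored graphs are treated as monochromatic. An arc-colored graph is a pair $(G,\lambda)$ with $\lambda$ defined on $\{(u,u)\mid u\in V(G)\}\cup\{(u,v)\mid \{u,v\}\in E(G)\}$ ($\lambda(u,u)$ is the vertex color, and possibly $\lambda(u,v)\ne\lambda(v,u)$). A graph is $k$-connected if it has more than $k$ vertices and removing fewer than $k$ vertices leaves it connected. For $k\ge2$, the $k$-dimensional Weisfeiler–Leman (WL) algorithm computes a coloring of $V(G)^k$: the initial color of $(v_1,\dots,v_k)$ consists of $(\lambda(v_1,v_2),0)$ if $(v_1,v_2)$ is in the domain of $\lambda$ and $(1,1)$ otherwise (for a vertex coloring $\lambda$ just $\lambda(v_1)$), together with the isomorphism type of the ordered induced subgraph on $(v_1,\dots,v_k)$; in each round the new color of $\bar v$ is the pair of its old color and the multiset, over $w\in V(G)$, of the $k$-tuples whose $i$-th component is the old color of $\bar v$ with its $i$-th entry replaced by $w$. Iteration stops at the stable coloring $\chi^k_G$; colors are canonical and comparable across graphs. For a vertex $s$, $\chi^k_G(s):=\chi^k_G(s,\dots,s)$. The algorithm distinguishes two graphs if some color is attained by different numbers of $k$-tuples in them. The $k$-dimensional WL algorithm correctly determines orbits in a set $\mathcal{H}$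 of graphs if for all arc-colored graphs $(G,\lambda),(G',\lambda')$ with $G,G'\in\mathcal{H}$ and all $s\in V(G)$, $s'\in V(G')$: there is an isomorphism from $(G,\lambda)$ to $(G',\lambda')$ mapping $s$ to $s'$ if and only if $\chi^k_G(s)=\chi^k_{G'}(s')$. *)

(* Defs.v *)
From mathcomp Require Import all_boot.
Set Implicit Arguments. Unset Strict Implicit. Unset Printing Implicit Defensive.

Record graph := Graph {
  gV : finType;
  gadj : rel gV;
  gadj_sym : symmetric gadj;
  gadj_irr : irreflexive gadj }.

Definition restr (G : graph) (A : {set gV G}) : rel (gV G) :=
  [rel a b | [&& a \in A, b \in A & gadj a b]].

Definition kconnected (k : nat) (G : graph) : Prop :=
  k < #|gV G| /\
  forall S : {set gV G}, #|S| < k ->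
    forall x y, x \notin S -> y \notin S -> connect (restr (~: S)) x y.

Definition is_minor (H G : graph) : Prop :=
  exists phi : gV H -> {set gV G},
    [/\ (forall u, phi u != set0),
        (forall u v, u != v -> [disjoint phi u & phi v]),
        (forall u x y, x \in phi u -> y \in phi u -> connect (restr (phi u)) x y)
      & (forall u v, gadj u v ->
           exists x y, [/\ x \in phi u, y \in phi v & gadj x y])].

Definition minor_closed (C : graph -> Prop) : Prop :=
  forall G H, C G -> is_minor H G -> C H.

Definition graph_iso (G G' : graph) : Prop :=
  exists f : gV G -> gV G', bijective f /\ forall u v, gadj (f u) (f v) = gadj u v.

(* Arc colorings: lam u u is the vertex color, lam u v (u,v adjacent) the arc
   color; values outside this domain are ignored. *)
Definition arc_coloring (G : graph) := gV G -> gV G -> nat.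

Definition acol_iso (G G' : graph) (l : arc_coloring G) (l' : arc_coloring G')
  (f : gV G -> gV G') : Prop :=
  [/\ bijective f,
      (forall u v, gadj (f u) (f v) = gadj u v),
      (forall u, l u u = l' (f u) (f u))
    & (forall u v, gadj u v -> l u v = l' (f u) (f v))].

Definition ktuple (k : nat) (G : graph) := {ffun 'I_k -> gV G}.

Definition entry (k : nat) (G : graph) (t : ktuple k G) (j : nat) : option (gV G) :=
  if (insub j : option 'I_k) is Some i then Some (t i) else None.

(* initial WL color: (lam(v1,v2),0) if (v1,v2) in the domain of lam, (1,1)
   otherwise, paired with the isomorphism type of the ordered induced
   subgraph (equality pattern and adjacency pattern). *)
Definition init_color (k : nat) (G : graph) (l : arc_coloring G) (t : ktuple k G)
  : (nat * nat) * {ffun 'I_k * 'I_k -> bool * bool} :=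
  (match entry t 0, entry t 1 with
   | Some a, Some b => if (a == b) || gadj a b then (l a b, 0) else (1, 1)
   | _, _ => (1, 1)
   end,
   [ffun ij : 'I_k * 'I_k => (t ij.1 == t ij.2, gadj (t ij.1) (t ij.2))]).

Definition upd (k : nat) (G : graph) (t : ktuple k G) (i : 'I_k) (w : gV G)
  : ktuple k G := [ffun j => if j == i then w else t j].

(* wl_eq r t t' : the round-r k-WL colors of t (in (G,l)) and t' (in (G',l'))
   coincide. Round r+1 color = (old color, multiset over w of the k-tuple of
   old colors of t[i:=w]); equality of these multisets across the two graphs is
   expressed by a color-preserving bijection of the vertex sets. *)
Fixpoint wl_eq (k : nat) (G G' : graph) (l : arc_coloring G) (l' : arc_coloring G')
  (r : nat) : ktuple k G -> ktuple k G' -> Prop :=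
  match r with
  | 0 => fun t t' => init_color l t = init_color l' t'
  | r.+1 => fun t t' =>
      wl_eq l l' r t t' /\
      exists f : gV G -> gV G', bijective f /\
        forall (w : gV G) (i : 'I_k), wl_eq l l' r (upd t i w) (upd t' i (f w))
  end.

Definition stable_eq (k : nat) (G G' : graph) (l : arc_coloring G) (l' : arc_coloring G')
  (t : ktuple k G) (t' : ktuple k G') : Prop :=
  forall r, wl_eq l l' r t t'.

Definition vcolor_eq (k : nat) (G G' : graph) (l : arc_coloring G) (l' : arc_coloring G')
  (s : gV G) (s' : gV G') : Prop :=
  stable_eq l l' ([ffun _ => s] : ktuple k G) ([ffun _ => s'] : ktuple k G').

Definition determines_orbits (k : nat) (Hc : graph -> Prop) : Prop :=
  forall G G' : graph, Hc G -> Hc G' ->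
  forall (l : arc_coloring G) (l' : arc_coloring G') (s : gV G) (s' : gV G'),
    (exists f, acol_iso l l' f /\ f s = s') <-> vcolor_eq k l l' s s'.

Definition mono (G : graph) : arc_coloring G := fun _ _ => 0.
Arguments mono G : clear implicits.

(* k-WL distinguishes G and G': some stable color is attained by different
   numbers of k-tuples, i.e. there is no bijection of k-tuples preserving
   stable colors. *)
Definition distinguishes (k : nat) (G G' : graph) : Prop :=
  ~ exists F : ktuple k G -> ktuple k G',
      bijective F /\ forall t, stable_eq (mono G) (mono G') t (F t).

(* Main.v *)
Require Import Defs.
From mathcomp Require Import all_boot.
From mathcomp Require Import boolp zify.
Set Implicit Arguments. Unset Strict Implicit. Unset Printing Implicit Defensive.

(** Write E for stable equivalence of k-tuples across two graphs. We show by
    induction on the number of vertices that E-equivalent vertices of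
    arc-colored graphs G, G' of the class force an isomorphism; to make the
    induction work, a root (a definable edge, or nothing) is carried along, and
    the isomorphism is required to follow the given pair on root vertices.

    If G has connectivity kappa <= 2, call a connected set K with kappa outer
    neighbors, missing the root and leaving other vertices, an end when it is of
    minimum size. The set D of vertices in ends is E-invariant: whether {a,b}
    separates x from y is determined by the colors of the four triples taken
    from a, b, x, y, because the walks from x to y that meet {a,b} are counted
    by a convolution over the first hit, and these walks are all the walks
    exactly when {a,b} separates. By Mader's argument on atoms, ends are
    disjoint and non-adjacent, except for ends that are single vertices of
    degree 2, which form paths (or G is a cycle, treated directly). So each
    component K of D has exactly kappa attachment vertices. Two kinds of
    smaller minors result: G - D, and K with its attachments, where attachment
    pairs become edges; both are colored by E-classes of pairs of G, so that
    winning strategies are inherited. The induction hypothesis then gives an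
    isomorphism of the first and, rooted at the attachments, isomorphisms of
    the pieces; counting vertices matches pieces with pieces, and the
    isomorphisms glue together. *)

(** * Stable equivalence as a bijective game *)

Section Stable.
Variable k : nat.

Lemma wl_eqS (G G' : graph) (l : arc_coloring G) (l' : arc_coloring G') r r'
    (t : ktuple k G) (t' : ktuple k G') :
  r <= r' -> wl_eq l l' r' t t' -> wl_eq l l' r t t'.
Proof.
elim: r' => [|r' IH]; first by rewrite leqn0 => /eqP->.
by rewrite leq_eqVlt => /predU1P[->//|le_rr'] /= [tt' _]; apply: IH.
Qed.

Lemma wl_eq_sym (G G' : graph) (l : arc_coloring G) (l' : arc_coloring G') r
    (t : ktuple k G) (t' : ktuple k G') :
  wl_eq l l' r t t' -> wl_eq l' l r t' t.
Proof.
elim: r t t' => [|r IH] t t' /=; first by move->.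
case=> /IH tt' [f [bij_f fP]]; split=> //.
case: (bij_f) => g fK gK; exists g; split; first by exists f.
by move=> w i; apply: IH; have := fP (g w) i; rewrite gK.
Qed.

Lemma wl_eq_trans (G1 G2 G3 : graph) (l1 : arc_coloring G1)
    (l2 : arc_coloring G2) (l3 : arc_coloring G3) r
    (t1 : ktuple k G1) (t2 : ktuple k G2) (t3 : ktuple k G3) :
  wl_eq l1 l2 r t1 t2 -> wl_eq l2 l3 r t2 t3 -> wl_eq l1 l3 r t1 t3.
Proof.
elim: r t1 t2 t3 => [|r IH] t1 t2 t3 /=; first by move->.
case=> t12 [f [bij_f fP]] [t23 [g [bij_g gP]]]; split; first exact: IH t12 t23.
exists (g \o f); split; first exact: bij_comp.
by move=> w i; apply: IH (fP w i) (gP (f w) i).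
Qed.

Lemma stable_eq_sym (G G' : graph) (l : arc_coloring G) (l' : arc_coloring G')
    (t : ktuple k G) (t' : ktuple k G') :
  stable_eq l l' t t' -> stable_eq l' l t' t.
Proof. by move=> tt' r; apply: wl_eq_sym. Qed.

Lemma stable_eq_trans (G1 G2 G3 : graph) (l1 : arc_coloring G1)
    (l2 : arc_coloring G2) (l3 : arc_coloring G3)
    (t1 : ktuple k G1) (t2 : ktuple k G2) (t3 : ktuple k G3) :
  stable_eq l1 l2 t1 t2 -> stable_eq l2 l3 t2 t3 -> stable_eq l1 l3 t1 t3.
Proof. by move=> t12 t23 r; apply: wl_eq_trans (t12 r) (t23 r). Qed.

(* There are finitely many bijections, so one of them works for all rounds. *)
Lemma stable_eq_step (G G' : graph) (l : arc_coloring G) (l' : arc_coloring G')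
    (t : ktuple k G) (t' : ktuple k G') :
  stable_eq l l' t t' ->
  exists f, bijective f /\
    forall w i, stable_eq l l' (upd t i w) (upd t' i (f w)).
Proof.
move=> tt'; apply: contrapT => nof.
have bad (f : {ffun gV G -> gV G'}) : exists r, bijective f ->
    ~ forall w i, wl_eq l l' r (upd t i w) (upd t' i (f w)).
  apply: contrapT => nr; apply: nof; exists f.
  suff [bf H] : bijective f /\ forall r w i,
      wl_eq l l' r (upd t i w) (upd t' i (f w)) by split=> // w i r; apply: H.
  split.
    by apply: contrapT => nb; apply: nr; exists 0.
  move=> r w i; apply: contrapT => nb; apply: nr; exists r => _ H; exact/nb/H.
have [R RP] := fin_all_exists bad.
pose r := \max_(f : {ffun gV G -> gV G'}) R f.
have [_ [f [bij_f fP]]] := tt' r.+1.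
pose g := finfun f; have gE : g =1 f by move=> x; rewrite ffunE.
apply: (RP g); first exact: eq_bij bij_f _ (fsym gE).
move=> w i; rewrite gE; apply: wl_eqS (fP w i); exact: leq_bigmax.
Qed.

(** A slot-symmetric strengthening of [init_color], which reads an arc color in the first two slots
    only. *)
Definition same_atoms (G G' : graph) (l : arc_coloring G) (l' : arc_coloring G')
    (t : ktuple k G) (t' : ktuple k G') : Prop :=
  forall i j, [/\ (t i == t j) = (t' i == t' j),
    gadj (t i) (t j) = gadj (t' i) (t' j)
    & (t i == t j) || gadj (t i) (t j) -> l (t i) (t j) = l' (t' i) (t' j)].

Lemma same_atoms_init (G G' : graph) (l : arc_coloring G) (l' : arc_coloring G')
    (t : ktuple k G) (t' : ktuple k G') :
  same_atoms l l' t t' -> init_color l t = init_color l' t'.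
Proof.
move=> tt'; rewrite /init_color /entry; congr pair; last first.
  by apply/ffunP=> -[i j]; rewrite !ffunE /=; case: (tt' i j) => -> ->.
case: insubP => [i _ _|//]; case: insubP => [j _ _|//].
by case: (tt' i j) => <- <-; case: ifP => // _ ->.
Qed.

(** Coinduction: a relation that respects atoms and is closed under the moves of the bijective game
    is a winning strategy, so no round separates related tuples. *)
Lemma simulation_stable (G G' : graph) (l : arc_coloring G) (l' : arc_coloring G')
    (R : ktuple k G -> ktuple k G' -> Prop) :
  (forall t t', R t t' -> same_atoms l l' t t') ->
  (forall t t', R t t' -> exists f, bijective f /\
     forall w i, R (upd t i w) (upd t' i (f w))) ->
  forall t t', R t t' -> stable_eq l l' t t'.
Proof.
move=> Ra Rs t t' tt' r; elim: r t t' tt' => [|r IH] t t' tt' /=.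
  exact/same_atoms_init/Ra.
split; first exact: IH.
by have [f [bf fP]] := Rs _ _ tt'; exists f; split=> // w i; apply: IH.
Qed.

Hypothesis k_ge3 : 2 < k.
Let k_gt0 : 0 < k := ltnW (ltnW k_ge3).
Let k_gt1 : 1 < k := ltnW k_ge3.
Definition slot0 : 'I_k := Ordinal k_gt0.
Definition slot1 : 'I_k := Ordinal k_gt1.
Definition slot2 : 'I_k := Ordinal k_ge3.

Lemma updE (G : graph) (t : ktuple k G) i w j :
  upd t i w j = if j == i then w else t j.
Proof. by rewrite ffunE. Qed.

Lemma stable_eq_eq (G G' : graph) (l : arc_coloring G) (l' : arc_coloring G')
    (t : ktuple k G) (t' : ktuple k G') i j :
  stable_eq l l' t t' -> (t i == t j) = (t' i == t' j).
Proof.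
by move=> tt'; have [_ /ffunP/(_ (i, j))] := tt' 0; rewrite !ffunE => -[].
Qed.

Lemma other_slot (i : 'I_k) : exists j, j != i.
Proof.
by case: (eqVneq i slot0) => [->|?]; [exists slot1 | exists slot0; rewrite eq_sym].
Qed.

Lemma stable_eq_step_val (G G' : graph) (l : arc_coloring G) (l' : arc_coloring G')
    (t : ktuple k G) (t' : ktuple k G') f j :
  (forall w i, stable_eq l l' (upd t i w) (upd t' i (f w))) -> f (t j) = t' j.
Proof.
move=> fP; have [i nij] := other_slot j.
have := stable_eq_eq i j (fP (t j) i); rewrite !updE eqxx [j == i]eq_sym (negPf nij) eqxx.
by move/esym/eqP.
Qed.

Lemma stable_eq_copy (G G' : graph) (l : arc_coloring G) (l' : arc_coloring G')
    (t : ktuple k G) (t' : ktuple k G') i j :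
  stable_eq l l' t t' -> stable_eq l l' (upd t i (t j)) (upd t' i (t' j)).
Proof.
move=> /stable_eq_step[f [_ fP]].
by have := fP (t j) i; rewrite (stable_eq_step_val j fP).
Qed.

(* [init_color] reads the arc color of the first two entries only; the others
   are moved there by copying entries. *)
Lemma stable_eq_atoms (G G' : graph) (l : arc_coloring G) (l' : arc_coloring G')
    (t : ktuple k G) (t' : ktuple k G') :
  stable_eq l l' t t' -> same_atoms l l' t t'.
Proof.
have c01 (u : ktuple k G) (u' : ktuple k G') : stable_eq l l' u u' ->
    (u slot0 == u slot1) || gadj (u slot0) (u slot1) ->
    l (u slot0) (u slot1) = l' (u' slot0) (u' slot1).
  move=> uu' h; have [+ /ffunP/(_ (slot0, slot1))] := uu' 0; rewrite !ffunE /=.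
  rewrite /entry (insubT (fun x => x < k) k_gt0) (insubT (fun x => x < k) k_gt1) /=.
  rewrite -[Sub 0 _]/slot0 -[Sub 1 _]/slot1.
  by move=> hu [eq_u adj_u]; move: hu; rewrite -eq_u -adj_u h => -[].
have cij (u : ktuple k G) (u' : ktuple k G') i j : j != slot0 ->
    stable_eq l l' u u' ->
    (u i == u j) || gadj (u i) (u j) -> l (u i) (u j) = l' (u' i) (u' j).
  move=> j0 uu'.
  have := stable_eq_copy slot1 j (stable_eq_copy slot0 i uu').
  by move/c01; rewrite !updE /= (negPf j0).
move=> tt' i j; split; first exact: stable_eq_eq tt'.
  by have [_ /ffunP/(_ (i, j))] := tt' 0; rewrite !ffunE => -[].
case: (eqVneq j slot0) => [->|j0]; last exact: cij tt'.
case: (eqVneq i slot1) => [->|i1].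
  have := cij _ _ slot1 slot2 _ (stable_eq_copy slot2 slot0 tt').
  by rewrite !updE /=; apply.
have := stable_eq_copy slot0 i (stable_eq_copy slot1 slot0 tt').
by move/c01; rewrite !updE /= (negPf i1).
Qed.

(** Pigeonhole: the [k - 1] slots other than [i] cannot have all [k] slots as images. The missed
    slot receives the next pebble of a simulated position. *)
Lemma free_slot (p : 'I_k -> 'I_k) i : exists j, forall l, l != i -> p l != j.
Proof.
apply: contrapT => nof.
have : #|[set p l | l in [set~ i]]| < #|'I_k|.
  apply: leq_ltn_trans (leq_imset_card _ _) _.
  by rewrite cardsC1 card_ord ltn_predL.
rewrite ltnNge -cardsT => /negP[]; apply/subset_leq_card/subsetP=> j _.
apply: contrapT => nj; apply: nof; exists j => l nli.
by apply/eqP=> plj; apply: nj; apply/imsetP; exists l; rewrite // !inE.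
Qed.

Definition covered (G G' : graph) (t : ktuple k G) (t' : ktuple k G')
    (u : ktuple k G) (u' : ktuple k G') :=
  forall i, exists j, t i = u j /\ t' i = u' j.

Lemma stable_eq_covered (G G' : graph) (l : arc_coloring G) (l' : arc_coloring G')
    (t : ktuple k G) (t' : ktuple k G') u u' :
  stable_eq l l' u u' -> covered t t' u u' -> stable_eq l l' t t'.
Proof.
pose R (t : ktuple k G) (t' : ktuple k G') :=
  exists u u', stable_eq l l' u u' /\ covered t t' u u'.
move=> uu' cov; apply: (@simulation_stable _ _ _ _ R); last by exists u, u'.
  move=> {uu' cov}t {}t' [{}u [{}u' [/stable_eq_atoms uu' cov]]] i j.
  by have [i1 [-> ->]] := cov i; have [j1 [-> ->]] := cov j.
move=> {uu' cov}t {}t' [{}u [{}u' [/stable_eq_step[f [bf fP]] cov]]].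
exists f; split=> // w i.
(* [p] locates each pebble of [t] in [u]. Slot [i] is about to be overwritten, so the other slots
   leave some slot [j] of [u] free for [w]. *)
have [p pP] := fin_all_exists cov.
have [j jP] := free_slot p i.
exists (upd u j w), (upd u' j (f w)); split; first exact: fP.
move=> i1; rewrite !updE; case: eqVneq => [_|n]; first by exists j; rewrite !updE eqxx.
by exists (p i1); rewrite !updE (negPf (jP _ n)); apply: pP.
Qed.

(** The third vertex fills all slots from 2 on, so a triple makes sense for every [k] at least 3. *)
Definition tr (G : graph) (a b c : gV G) : ktuple k G :=
  [ffun i : 'I_k => if i == 0 :> nat then a else if i == 1 :> nat then b else c].

Lemma tr0 (G : graph) (a b c : gV G) : tr a b c slot0 = a. Proof. by rewrite ffunE. Qed.
Lemma tr1 (G : graph) (a b c : gV G) : tr a b c slot1 = b. Proof. by rewrite ffunE. Qed.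
Lemma tr2 (G : graph) (a b c : gV G) : tr a b c slot2 = c. Proof. by rewrite ffunE. Qed.

Definition E3 (G G' : graph) (l : arc_coloring G) (l' : arc_coloring G')
    (a b c : gV G) (a' b' c' : gV G') :=
  stable_eq l l' (tr a b c) (tr a' b' c').

Lemma tr_slot (G G' : graph) (a b c : gV G) (a' b' c' : gV G') i :
  [\/ tr a b c i = a /\ tr a' b' c' i = a', tr a b c i = b /\ tr a' b' c' i = b'
    | tr a b c i = c /\ tr a' b' c' i = c'].
Proof.
by rewrite !ffunE; case: ifP => _; [apply: Or31 | case: ifP => _; [apply: Or32 | apply: Or33]].
Qed.

Lemma stable_eq_E3 (G G' : graph) (l : arc_coloring G) (l' : arc_coloring G')
    (t : ktuple k G) (t' : ktuple k G') i j m :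
  stable_eq l l' t t' -> E3 l l' (t i) (t j) (t m) (t' i) (t' j) (t' m).
Proof.
move=> tt'; apply: stable_eq_covered tt' _ => n.
by case: (tr_slot (t i) (t j) (t m) (t' i) (t' j) (t' m) n) => -[-> ->];
  [exists i | exists j | exists m].
Qed.

Definition sel3 (T : Type) (a b c : T) (i : nat) :=
  if i is 0 then a else if i is 1 then b else c.

Lemma E3_sel (i j m : nat) (G G' : graph) (l : arc_coloring G) (l' : arc_coloring G')
    a b c a' b' c' : E3 l l' a b c a' b' c' ->
  E3 l l' (sel3 a b c i) (sel3 a b c j) (sel3 a b c m)
          (sel3 a' b' c' i) (sel3 a' b' c' j) (sel3 a' b' c' m).
Proof.
pose sl i := sel3 slot0 slot1 slot2 i.
have slE (H : graph) (x y z : gV H) n : tr x y z (sl n) = sel3 x y z n.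
  by case: n => [|[|n]]; rewrite ?tr0 ?tr1 ?tr2.
by move=> /(stable_eq_E3 (sl i) (sl j) (sl m)); rewrite !slE.
Qed.

Lemma E3_step (G G' : graph) (l : arc_coloring G) (l' : arc_coloring G')
    a b c a' b' c' : E3 l l' a b c a' b' c' ->
  exists f, [/\ bijective f, [/\ f a = a', f b = b' & f c = c'] &
    forall y, [/\ E3 l l' y b c (f y) b' c', E3 l l' a y c a' (f y) c'
                & E3 l l' a b y a' b' (f y)]].
Proof.
move=> /[dup] abc /stable_eq_step[f [bf fP]].
exists f; split=> //.
  split; first by have := stable_eq_step_val slot0 fP; rewrite !tr0.
    by have := stable_eq_step_val slot1 fP; rewrite !tr1.
  by have := stable_eq_step_val slot2 fP; rewrite !tr2.
move=> y; split.
- have := stable_eq_E3 slot0 slot1 slot2 (fP y slot0).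
  by rewrite !updE /= !tr1 !tr2.
- have := stable_eq_E3 slot0 slot1 slot2 (fP y slot1).
  by rewrite !updE /= !tr0 !tr2.
have := stable_eq_E3 slot0 slot1 slot2 (fP y slot2).
by rewrite !updE /= !tr0 !tr1.
Qed.

Lemma E3_sym (G G' : graph) (l : arc_coloring G) (l' : arc_coloring G')
    a b c a' b' c' : E3 l l' a b c a' b' c' -> E3 l' l a' b' c' a b c.
Proof. exact: stable_eq_sym. Qed.

Lemma E3_atoms (G G' : graph) (l : arc_coloring G) (l' : arc_coloring G')
    a b c a' b' c' : E3 l l' a b c a' b' c' ->
  [/\ (a == b) = (a' == b'), gadj a b = gadj a' b'
    & (a == b) || gadj a b -> l a b = l' a' b'].
Proof. by move/stable_eq_atoms/(_ slot0 slot1); rewrite !tr0 !tr1. Qed.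

Definition E2 (G G' : graph) (l : arc_coloring G) (l' : arc_coloring G')
  (a b : gV G) (a' b' : gV G') := E3 l l' a b b a' b' b'.

Definition E1 (G G' : graph) (l : arc_coloring G) (l' : arc_coloring G')
  (a : gV G) (a' : gV G') := E3 l l' a a a a' a' a'.

Lemma vcolor_E1 (G G' : graph) (l : arc_coloring G) (l' : arc_coloring G') s s' :
  vcolor_eq k l l' s s' <-> E1 l l' s s'.
Proof.
have trE (H : graph) (x : gV H) : [ffun _ => x] = tr x x x.
  by apply/ffunP=> i; rewrite !ffunE; do 2?case: ifP.
by rewrite /vcolor_eq !trE.
Qed.

End Stable.

(** * Fragments and ends *)

Section Fragments.
Variable G : graph.
Local Notation V := (gV G).
Implicit Types (A B K S M : {set V}) (x y z : V).

Definition nb A := [set y | (y \notin A) && [exists x in A, gadj x y]].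
Definition co A := ~: (A :|: nb A).
Definition frag A := (A != set0) && (co A != set0).
(** Since [connect] is reflexive, this is the singleton of [x] when [x] lies outside [B]. *)
Definition component B x := [set y | connect (restr B) x y].

Lemma nbP A y : reflect (y \notin A /\ exists2 x, x \in A & gadj x y) (y \in nb A).
Proof.
rewrite inE; apply: (iffP andP) => -[yA].
  by move/exists_inP.
by move=> h; split=> //; apply/exists_inP.
Qed.

Lemma mem_nb A x y : x \in A -> gadj x y -> y \notin A -> y \in nb A.
Proof. by move=> xA xy yA; apply/nbP; split=> //; exists x. Qed.

Lemma co_adj A x y : x \in A -> y \in co A -> gadj x y = false.
Proof.
move=> xA; rewrite !inE negb_or => /andP[yA]; rewrite yA /= => /exists_inP nxy.
by apply/negP=> xy; apply: nxy; exists x.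
Qed.

Lemma coP A y : reflect (y \notin A /\ forall x, x \in A -> ~~ gadj x y) (y \in co A).
Proof.
rewrite !inE negb_or; apply: (iffP andP) => -[yA].
  rewrite yA /= => /exists_inP nxy; split=> // x xA.
  by apply/negP=> xy; apply: nxy; exists x.
move=> h; split=> //; rewrite yA /=; apply/exists_inP=> -[x xA]; exact/negP/h.
Qed.

Lemma nb_co A : nb (co A) \subset nb A.
Proof.
apply/subsetP=> y /nbP[yc [x /coP[xA nx] xy]].
move: yc; rewrite inE negbK inE => /orP[yA|//].
by have := nx _ yA; rewrite gadj_sym xy.
Qed.

Lemma co_sub A B : A \subset B -> co B \subset co A.
Proof.
move=> sAB; apply/subsetP=> y /coP[yB h]; apply/coP; split.
  by apply: contra yB; apply: subsetP.
by move=> x xA; apply/h/(subsetP sAB).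
Qed.

Lemma co_co A : A \subset co (co A).
Proof.
apply/subsetP=> x xA; apply/coP; split.
  by apply/negP=> /coP[/negP].
by move=> y /(co_adj xA) h; rewrite gadj_sym h.
Qed.

Lemma frag_sub A B : A \subset B -> A != set0 -> frag B -> frag A.
Proof.
move=> sAB A0 /andP[_ /set0Pn[y yB]]; rewrite /frag A0; apply/set0Pn; exists y.
exact: subsetP (co_sub sAB) _ yB.
Qed.

Lemma frag_co A : frag A -> frag (co A).
Proof.
case/andP=> /set0Pn[x xA] cA; rewrite /frag cA /=; apply/set0Pn; exists x.
exact: (subsetP (co_co A)).
Qed.

Lemma card_frag A : #|V| = #|A| + #|nb A| + #|co A|.
Proof.
rewrite -(cardsC (A :|: nb A)) -/(co A) cardsU.
suff -> : A :&: nb A = set0 by rewrite cards0 subn0.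
by apply/setP=> x; rewrite !inE; case: (x \in A).
Qed.

Lemma cardE_sum A : #|A| = \sum_z (z \in A).
Proof. by rewrite -sum1_card big_mkcond; apply: eq_bigr => z _; case: (z \in A). Qed.

(** Vertexwise count: a vertex in both sets on the left is outside [A] and [B] with a neighbor in
    [A :&: B], so it is in both sets on the right. *)
Lemma nb_submod A B : #|nb (A :&: B)| + #|nb (A :|: B)| <= #|nb A| + #|nb B|.
Proof.
rewrite !cardE_sum -!big_split; apply: leq_sum => z _ /=.
have [/nbP[zI [x /setIP[xA xB] xz]]|_] := boolP (z \in nb (A :&: B)).
  have [/nbP[/=]|_] := boolP (z \in nb (A :|: B)).
    rewrite inE negb_or => /andP[zA zB] _.
    by rewrite (mem_nb xA xz zA) (mem_nb xB xz zB).
  move: zI; rewrite inE negb_and => /orP[zA|zB].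
    by rewrite (mem_nb xA xz zA).
  by rewrite (mem_nb xB xz zB); apply: leq_addl.
have [/nbP[/=]|//] := boolP (z \in nb (A :|: B)).
rewrite inE negb_or => /andP[zA zB] [x /setUP[xA|xB] xz].
  by rewrite (mem_nb xA xz zA).
by rewrite (mem_nb xB xz zB); apply: leq_addl.
Qed.

(** Vertexwise count for opposite corners: by [key], a neighbor of one corner is in [nb A] or
    [nb B], and a neighbor of both corners is in both. *)
Lemma nb_submod_co A B :
  #|nb (A :&: co B)| + #|nb (co A :&: B)| <= #|nb A| + #|nb B|.
Proof.
have key A1 B1 z : z \in nb (A1 :&: co B1) -> [/\ exists2 x, x \in A1 & gadj x z,
    z \notin B1 & (z \in nb A1) || (z \in nb B1)].
  case/nbP=> zI [x /setIP[xA xB] xz].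
  have zB : z \notin B1 by apply/negP=> /co_adj/(_ xB); rewrite gadj_sym xz.
  split=> //; first by exists x.
  have [zA|zA] := boolP (z \in A1); last by rewrite (mem_nb xA xz zA).
  move: zI; rewrite inE zA /= inE negbK inE (negPf zB) /= => ->; exact: orbT.
rewrite !cardE_sum -!big_split; apply: leq_sum => z _ /=.
have [/key[[x xA xz] zB zAB]|_] := boolP (z \in nb (A :&: co B)).
  have [|_] := boolP (z \in nb (co A :&: B)); last by move: zAB; do 2!case: (z \in _).
  rewrite setIC => /key[[y yB yz] zA _].
  by rewrite (mem_nb xA xz zA) (mem_nb yB yz zB).
have [|//] := boolP (z \in nb (co A :&: B)).
by rewrite setIC => /key[_ _]; do 2!case: (z \in _).
Qed.

Lemma restr_sym B : symmetric (restr B).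
Proof. by move=> x y; rewrite /restr /= gadj_sym andbCA. Qed.

Lemma component_sym B x y : (y \in component B x) = (x \in component B y).
Proof. rewrite !inE; exact/sym_connect_sym/restr_sym. Qed.

Lemma component_refl B x : x \in component B x. Proof. by rewrite inE. Qed.

Lemma component_eq B x y : y \in component B x -> component B y = component B x.
Proof.
move=> yx; apply/setP=> z; rewrite !inE; apply/idP/idP => h.
  by apply: connect_trans h; rewrite inE in yx.
by apply: connect_trans h; rewrite component_sym inE in yx.
Qed.

Lemma component_sub B x : x \in B -> component B x \subset B.
Proof.
move=> xB; apply/subsetP=> y; rewrite inE => /connectP[p + ->] {y}.
by elim: p x xB => //= z p IH x xB /andP[/and3P[_ zB _]]; apply: IH.
Qed.

Lemma component_adj B x y z : y \in component B x -> y \in B -> z \in B -> gadj y z -> z \in component B x.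
Proof.
rewrite !inE => xy yB zB yz; apply: connect_trans xy (connect1 _).
by rewrite /restr /= yB zB.
Qed.

Lemma nb_component B x : x \in B -> nb (component B x) \subset ~: B.
Proof.
move=> xB; apply/subsetP=> y /nbP[ny [z zx zy]]; rewrite inE.
apply: contra ny => yB; apply: (component_adj zx _ yB zy).
exact: subsetP (component_sub xB) _ zx.
Qed.

Lemma component_closed B A x : x \in A -> nb A \subset ~: B -> component B x \subset A.
Proof.
move=> xA nA; apply/subsetP=> y; rewrite inE => /connectP[p + ->] {y}.
elim: p x xA => //= z p IH x xA /andP[/and3P[_ zB xz]]; apply: IH.
apply: contraTT zB => zA; have := subsetP nA _ (mem_nb xA xz zA).
by rewrite inE.
Qed.

(* [kappa] is the connectivity, and [m] the size of the smallest minimum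
   fragments disjoint from the root [M]. *)
Definition is_end kappa m M K :=
  [&& frag K, #|nb K| == kappa, [disjoint K & M] & #|K| == m].

Definition min_ends kappa m M :=
  [/\ forall A, frag A -> kappa <= #|nb A|,
      forall A, frag A -> #|nb A| = kappa -> [disjoint A & M] -> m <= #|A|
    & exists K, is_end kappa m M K].

(** An edge cannot have ends on both sides of a separator, so a fragment that meets the root has a
    far side free of it. *)
Definition root M :=
  M = set0 \/ #|M| = 2 /\ forall x y, x \in M -> y \in M -> x != y -> gadj x y.

Variables (kappa m : nat) (M : {set V}).
Hypotheses (kappa_le2 : kappa <= 2) (rootM : root M) (minE : min_ends kappa m M).

Lemma end_neq0 K : is_end kappa m M K -> K != set0.
Proof. by case/and4P=> /andP[]. Qed.

(** A component of an end has no more outer neighbors than the end, so minimality makes it the whole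
    end. Ends are thus recovered from their separator and one vertex. *)
Lemma end_component K x : is_end kappa m M K -> x \in K -> K = component (~: nb K) x.
Proof.
case: minE => km mm _ /and4P[fK /eqP nK dK /eqP cK] xK.
have sK : component (~: nb K) x \subset K by apply: component_closed; rewrite // setCK.
have fc : frag (component (~: nb K) x).
  by apply: frag_sub sK _ fK; apply/set0Pn; exists x; apply: component_refl.
have nc : nb (component (~: nb K) x) \subset nb K.
  rewrite -{2}[nb K]setCK; apply: nb_component; rewrite inE; apply/negP=> /nbP[].
  by rewrite xK.
apply/esym/eqP; rewrite eqEcard sK cK; apply: mm => //.
  by apply/eqP; rewrite eqn_leq km // -nK subset_leq_card.
exact: disjointWl sK dK.
Qed.

(** Submodularity: either the intersection has exactly [kappa] outer neighbors and minimality makes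
    it equal to both ends, or the union has fewer than [kappa], so that its far side is empty. *)
Lemma ends_eq K1 K2 x : is_end kappa m M K1 -> is_end kappa m M K2 ->
  x \in K1 -> x \in K2 -> K1 = K2.
Proof.
move=> e1 e2 x1 x2; case: minE => km mm _.
case/and4P: (e1) => f1 /eqP n1 d1 /eqP c1; case/and4P: (e2) => f2 /eqP n2 d2 /eqP c2.
have fI : frag (K1 :&: K2).
  by apply: frag_sub (subsetIl _ _) _ f1; apply/set0Pn; exists x; apply/setIP.
have dI : [disjoint K1 :&: K2 & M] by apply: disjointWl (subsetIl _ _) d1.
have := nb_submod K1 K2; rewrite n1 n2 => sm.
have := km _ fI; rewrite leq_eqVlt => /predU1P[nI|nI].
  have cI := mm _ fI (esym nI) dI.
  have I1 : K1 :&: K2 = K1 by apply/eqP; rewrite eqEcard subsetIl c1.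
  have I2 : K1 :&: K2 = K2 by apply/eqP; rewrite eqEcard subsetIr c2.
  by rewrite -I1 {1}I2.
have nU : #|nb (K1 :|: K2)| < kappa.
  by rewrite -(leq_add2l kappa) addnS; apply: leq_trans sm; rewrite -addSn leq_add2r.
have cU0 : co (K1 :|: K2) = set0.
  apply/eqP; apply: contraTT nU => cU; rewrite -leqNgt km // /frag cU andbT.
  by apply/set0Pn; exists x; rewrite inE x1.
(* Without a root, [co K1] has at least [m] vertices, so the union and its neighbors are too few to
   cover the graph. With a root, its two vertices would lie among the fewer than [kappa] neighbors
   of the union. *)
exfalso; case: rootM => [M0|[cM _]].
  have := mm _ (frag_co f1); have := card_frag (K1 :|: K2).
  rewrite cU0 cards0 (card_frag K1) n1 c1 cardsU c1 c2.
  have : 0 < #|K1 :&: K2| by apply/card_gt0P; exists x; apply/setIP.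
  have := subset_leq_card (nb_co K1); have := km _ (frag_co f1).
  rewrite n1 M0 disjoint_sym disjoints_subset sub0set => h1 h2 h3 h4.
  have nco : #|nb (co K1)| = kappa by apply/eqP; rewrite eqn_leq h2 h1.
  by move/(_ nco isT)=> h5; clear -nU h3 h4 h5; lia.
suff : #|M| <= #|nb (K1 :|: K2)| by move=> h; clear -nU h cM kappa_le2; lia.
apply/subset_leq_card/subsetP=> y yM.
have : y \in co (K1 :|: K2) = false by rewrite cU0 inE.
rewrite inE in_setU => /negbFE/orP[/setUP[]|//] => yK.
  by have := disjointFr d1 yK; rewrite yM.
by have := disjointFr d2 yK; rewrite yM.
Qed.

(* Mader's argument on atoms: [K1] and [K2] are uncrossed against the far sides
   of each other by submodularity. *)
Lemma ends_nadj K1 K2 x : ~ (kappa = 2 /\ m = 1) ->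
  is_end kappa m M K1 -> is_end kappa m M K2 -> K1 <> K2 ->
  x \in K1 -> x \in nb K2 -> False.
Proof.
move=> nkm.
(* If [K1'] misses the far side of [K2'], it lies in [nb K2']; excluding [kappa = 2], [m = 1] leaves
   [m = kappa] and [K1' = nb K2']. Then either each end is the neighborhood of the other and their
   union has no outer neighbor, or some vertex of [K2'] without neighbors in [K1'] has fewer than
   [kappa] neighbors. *)
have key K1' K2' : is_end kappa m M K1' -> is_end kappa m M K2' -> K1' <> K2' ->
    K1' :&: co K2' = set0 -> False.
  move=> {K1 K2} e1 e2 n12 A0; case: minE => km mm _.
  case/and4P: (e1) => f1 /eqP n1 d1 /eqP c1; case/and4P: (e2) => f2 /eqP n2 d2 /eqP c2.
  have s1 : K1' \subset nb K2'.
    apply/subsetP=> y y1; have : y \in K1' :&: co K2' = false by rewrite A0 inE.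
    rewrite inE y1 /= inE => /negbFE; rewrite in_setU => /orP[y2|//].
    by case: n12; apply: ends_eq y1 y2.
  have m0 : 0 < m by rewrite -c1 card_gt0 end_neq0.
  have := subset_leq_card s1; rewrite c1 n2 leq_eqVlt => /predU1P[mk|mk]; last first.
    by apply: nkm; clear -mk m0 kappa_le2; lia.
  have e12 : K1' = nb K2' by apply/eqP; rewrite eqEcard s1 c1 n2 mk leqnn.
  have [s2|/subsetPn[t t2 tn]] := boolP (K2' \subset nb K1').
    have e21 : K2' = nb K1' by apply/eqP; rewrite eqEcard s2 c2 n1 mk leqnn.
    have nU : nb (K1' :|: K2') = set0.
      apply/setP=> y; rewrite [RHS]inE; apply/negP=> /nbP[].
      rewrite inE negb_or => /andP[y1 y2] [z /setUP[z1|z2] zy].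
        by have := mem_nb z1 zy y1; rewrite -e21 (negPf y2).
      by have := mem_nb z2 zy y2; rewrite -e12 (negPf y1).
    have := km (K1' :|: K2'); rewrite nU cards0.
    suff -> : frag (K1' :|: K2') by move/(_ isT); clear -m0 mk; lia.
    apply/andP; split.
      apply: contra (end_neq0 e1); rewrite -!subset0; apply: subset_trans.
      exact: subsetUl.
    rewrite /co nU setU0 e21; by case/andP: f1.
  have nt : nb [set t] \subset K2' :\ t.
    apply/subsetP=> y /nbP[]; rewrite !inE => yt [z]; rewrite inE => /eqP-> ty.
    rewrite yt; have [//|y2] := boolP (y \in K2').
    have := mem_nb t2 ty y2; rewrite -e12 => y1.
    rewrite gadj_sym in ty; have := tn; rewrite (mem_nb y1 ty) //.
    by rewrite e12; apply/negP=> /nbP[]; rewrite t2.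
  have := subset_leq_card nt; have := cardsD1 t K2'; rewrite t2 c2.
  have := km [set t] _; rewrite (frag_sub _ _ f2) ?sub1set //.
    by move/(_ isT)=> h1 h2 h3; clear -h1 h2 h3 mk; lia.
  by apply/set0Pn; exists t; rewrite inE.
move=> e1 e2 n12 x1 x2; case: minE => km mm _.
case/and4P: (e1) => f1 /eqP n1 d1 /eqP c1; case/and4P: (e2) => f2 /eqP n2 d2 /eqP c2.
have [/key|A0] := eqVneq (K1 :&: co K2) set0; first exact.
have [B0|B0] := eqVneq (co K1 :&: K2) set0.
  by apply: (key K2 K1) => //; [exact/nesym|rewrite setIC].
have fA : frag (K1 :&: co K2) := frag_sub (subsetIl _ _) A0 f1.
have fB : frag (co K1 :&: K2) := frag_sub (subsetIr _ _) B0 f2.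
have := nb_submod_co K1 K2; have := km _ fA; have := km _ fB; rewrite n1 n2.
move=> kB kA sm.
(* Both corners have at least [kappa] outer neighbors and together at most twice [kappa]. So
   [K1 :&: co K2] is a minimum fragment, and it is smaller than [K1] because it omits [x]. *)
have nA : #|nb (K1 :&: co K2)| = kappa.
  apply/eqP; rewrite eqn_leq kA andbT -(leq_add2r kappa).
  by apply: leq_trans sm; rewrite leq_add2l.
have := mm _ fA nA (disjointWl (subsetIl _ _) d1).
rewrite leqNgt => /negP[]; rewrite -c1.
apply: proper_card; rewrite properE subsetIl /=; apply/subsetPn; exists x => //.
by rewrite inE x1 /= in_setC negbK in_setU x2 orbT.
Qed.

Definition ends_union := [set x | [exists K, is_end kappa m M K && (x \in K)]].

Lemma ends_unionP x :
  reflect (exists2 K, is_end kappa m M K & x \in K) (x \in ends_union).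
Proof. by rewrite inE; apply: (iffP exists_inP). Qed.

Lemma end_piece x : ~ (kappa = 2 /\ m = 1) -> x \in ends_union ->
  #|nb (component ends_union x)| = kappa /\ co (component ends_union x) != set0.
Proof.
move=> nkm xD; have [K eK xK] := ends_unionP _ xD.
have sKD : K \subset ends_union by apply/subsetP=> y yK; apply/ends_unionP; exists K.
have sK : component ends_union x \subset K.
  apply: component_closed => //; apply/subsetP=> y yn; rewrite inE.
  apply/negP=> /ends_unionP[K2 e2 y2].
  apply: (ends_nadj nkm e2 eK _ y2 yn) => e; case/nbP: yn.
  by rewrite -e y2.
suff -> : component ends_union x = K by case/and4P: eK => /andP[_ ->] /eqP.
apply/eqP; rewrite eqEsubset sK {1}(end_component eK xK) /=.
apply: component_closed; first exact: component_refl.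
rewrite setCK; apply/subsetP=> y yn.
have yD : y \notin ends_union by have := subsetP (nb_component xD) _ yn; rewrite inE.
have [_ [z zx zy]] := nbP _ _ yn; apply: mem_nb zy _; first exact: (subsetP sK).
by apply: contra yD; apply: subsetP.
Qed.

(** Counting directed edges rather than outer neighbors registers several edges to the same outer
    vertex, on which [path_piece] relies. *)
Definition boundary A := [set p : V * V | [&& p.1 \in A, p.2 \notin A & gadj p.1 p.2]].

Lemma in_boundary A x y :
  ((x, y) \in boundary A) = [&& x \in A, y \notin A & gadj x y].
Proof. by rewrite inE. Qed.

Lemma nb1E x y : (y \in nb [set x]) = gadj x y.
Proof.
apply/nbP/idP => [[_ [z]]|xy]; first by rewrite inE => /eqP->.
split; last by exists x; rewrite ?inE.
by rewrite inE; apply/eqP=> e; rewrite e gadj_irr in xy.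
Qed.

Lemma card_nb_boundary A : #|nb A| <= #|boundary A|.
Proof.
apply: leq_trans (leq_imset_card (fun p : V * V => p.2) _).
apply/subset_leq_card/subsetP=> y /nbP[yA [x xA xy]].
by apply/imsetP; exists (x, y); rewrite ?inE /= ?xA ?yA.
Qed.

(** The edge [(u, v)] stops leaving the set, and only the one other edge at [v] can start to. *)
Lemma boundaryU1 A u v : u \in A -> v \notin A -> gadj u v -> #|nb [set v]| = 2 ->
  #|boundary (v |: A)| <= #|boundary A|.
Proof.
move=> uA vA uv v2.
have uvB : (u, v) \in boundary A by rewrite inE /= uA vA uv.
have s : boundary (v |: A) \subset
    (boundary A :\ (u, v)) :|: [set (v, w) | w in nb [set v] :\ u].
  apply/subsetP=> -[a b]; rewrite !inE /= negb_or.
  case/and3P=> /predU1P[-> /andP[bv bA] vb|aA /andP[bv bA] ab].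
    apply/orP; right; apply/imsetP; exists b => //; rewrite inE nb1E vb andbT inE.
    by apply: contraNneq bA => ->.
  by rewrite aA bA ab xpair_eqE (negPf bv) andbF.
apply: leq_trans (subset_leq_card s) _.
apply: leq_trans (leq_card_setU _ _) _; rewrite (cardsD1 (u, v) (boundary A)) uvB addnC.
rewrite leq_add2r; apply: leq_trans (leq_imset_card _ _) _.
by have := cardsD1 u (nb [set v]); rewrite v2 nb1E gadj_sym uv add1n => h; rewrite -ltnS -h.
Qed.

(* When the ends are single vertices of degree 2, the components of the graph
   they induce are paths; a boundary count shows that such a path is a proper
   piece with two attachment vertices, unless the whole graph is a cycle. *)
Lemma path_piece x z : kappa = 2 -> m = 1 -> 3 < #|V| -> #|nb [set z]| != 2 ->
  x \in ends_union ->
  #|nb (component ends_union x)| = kappa /\ co (component ends_union x) != set0.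
Proof.
move=> k2 m1 V4 z2 xD; case: minE => km mm _.
set D := ends_union in xD *; set K := component D x.
have deg2 y : y \in D -> #|nb [set y]| = 2.
  case/ends_unionP=> K1 /and4P[_ /eqP + _]; rewrite k2 m1 => + /cards1P[v e].
  by rewrite e inE => n1 /eqP->.
(* If all other vertices are adjacent to [z], there are at least 3 of them. Otherwise the singleton
   of [z] is a fragment, with at least [kappa = 2] neighbors. *)
have z3 : 2 < #|nb [set z]|.
  rewrite ltn_neqAle eq_sym z2 -{1}k2; have := card_frag [set z].
  have [c0|c0] := eqVneq (co [set z]) set0; first by rewrite c0 cards0 cards1 k2 => h; clear -h V4; lia.
  by move=> _; apply: km; rewrite /frag c0 andbT; apply/set0Pn; exists z; rewrite inE.
have KD : K \subset D := component_sub xD.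
(* A maximal such set absorbs every neighbor in [D], all of which have degree 2, so it is all of
   [K]. *)
pose P (X : {set V}) := [&& X \subset K, x \in X & #|boundary X| <= 2].
have P1 : P [set x].
  rewrite /P sub1set component_refl inE eqxx /= -(deg2 _ xD).
  apply: leq_trans (leq_imset_card (pair x) _).
  apply/subset_leq_card/subsetP=> -[a b]; rewrite !inE /= => /and3P[/eqP-> _ ab].
  by apply/imsetP; exists b; rewrite ?nb1E.
have [X /maxsetP[/and3P[XK xX eX] maxX]] := ex_maxset (ex_intro (fun X => P X) _ P1).
have eK : #|boundary K| <= 2.
  have [KX|/negP KX] := boolP (K \subset X).
    by have <- : X = K by apply/eqP; rewrite eqEsubset XK.
  case: KX; apply: component_closed => //; apply/subsetP=> v vn; rewrite inE.
  apply/negP=> vD; have [vX [u uX uv]] := nbP _ _ vn; case/negP: vX.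
  have uK := subsetP XK _ uX.
  rewrite -(maxX (v |: X)) ?subsetUr ?setU11 // /P subUset sub1set XK setU1r // andbT.
  rewrite (component_adj uK (subsetP KD _ uK) vD uv) /=.
  by apply: leq_trans eX; apply: boundaryU1 uX _ uv (deg2 _ vD); case/nbP: vn.
have nK := leq_trans (card_nb_boundary K) eK.
have [c0|c0] := eqVneq (co K) set0; last first.
  split=> //; apply/eqP; rewrite eqn_leq {1}k2 nK; apply: km; rewrite /frag c0 andbT.
  by apply/set0Pn; exists x; apply: component_refl.
(* With an empty far side, [z] is an outer neighbor of [K]. Its degree then forces three edges to
   leave [K]: three to [z], or two to [z] and one to the other outer neighbor [w]. *)
have zK : z \notin K by apply/negP=> /(subsetP KD)/deg2/eqP; apply/negP.
have inV y : (y \in K) || (y \in nb K).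
  have : y \in co K = false by rewrite c0 inE.
  by rewrite inE in_setU => /negbFE.
have zn : z \in nb K by have := inV z; rewrite (negPf zK).
pose Kz := [set u in K | gadj u z].
have cKz : #|nb [set z]| <= #|Kz| + (#|nb K|.-1).
  rewrite (cardsD1 z (nb K)) zn /=.
  apply: leq_trans (leq_card_setU _ _); apply/subset_leq_card/subsetP=> y.
  rewrite nb1E => zy; have /orP[yK|yn] := inV y; apply/setUP; [left|right].
    by apply/setIdP; rewrite gadj_sym.
  by apply/setD1P; split=> //; apply: contraTneq zy => ->; rewrite gadj_irr.
have sz : [set (u, z) | u in Kz] \subset boundary K.
  by apply/subsetP=> _ /imsetP[u /setIdP[uK uz] ->]; rewrite in_boundary uK zK.
have cz : #|[set (u, z) | u in Kz]| = #|Kz| by apply: card_imset => a b [].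
have := subset_leq_card sz; rewrite cz => h.
have [nw|[w /setD1P[wz wn]]] := set_0Vmem (nb K :\ z).
  by have := cardsD1 z (nb K); rewrite zn nw cards0 => h'; clear -h h' cKz z3 eK; lia.
have [wK [u uK uw]] := nbP _ _ wn.
have s' : (u, w) |: [set (u, z) | u in Kz] \subset boundary K.
  by rewrite subUset sub1set sz in_boundary uK wK uw.
have := subset_leq_card s'; rewrite cardsU1 cz.
have -> : (u, w) \notin [set (u, z) | u in Kz].
  by apply/negP=> /imsetP[u' _ [_ e]]; rewrite e eqxx in wz.
by move=> h'; clear -h h' cKz z3 nK eK; lia.
Qed.

End Fragments.

(** * Walk counts and invariance of separation *)

Section Walks.
Variable G : graph.
Local Notation V := (gV G).
Implicit Types (x y z : V) (S : {set V}).

Fixpoint walks n x y : nat :=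
  if n is n'.+1 then \sum_(z | gadj x z) walks n' z y else x == y.

Fixpoint avoiding S n x y : nat :=
  if n is n'.+1 then (x \notin S) * \sum_(z | gadj x z) avoiding S n' z y
  else (x \notin S) && (x == y).

(** Walks of length [n] from [x] that meet [S] only at their last vertex, which is [c]. *)
Fixpoint first_hits S c n x : nat :=
  if n is n'.+1 then (x \notin S) * \sum_(z | gadj x z) first_hits S c n' z
  else (x \in S) && (x == c).

(** A walk avoids [S], or splits uniquely at its first vertex [c] in [S], reached after [j]
    steps. *)
Lemma walks_split S n x y :
  walks n x y = avoiding S n x y
    + \sum_(j < n.+1) \sum_(c in S) first_hits S c j x * walks (n - j) c y.
Proof.
elim: n x => [|n IH] x; have [xS|xS] := boolP (x \in S).
- rewrite big_ord_recl big_ord0 addn0 subn0 /= xS /= (bigD1 x xS) /= eqxx mul1n.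
  by rewrite big1 ?addn0 // => c /andP[_]; rewrite eq_sym => /negPf->.
- rewrite big_ord_recl big_ord0 addn0 /= xS (negPf xS) /= big1 ?addn0 //.
- rewrite big_ord_recl subn0 /= xS /= mul0n add0n (bigD1 x xS) /= eqxx mul1n.
  rewrite -[LHS]addn0 -addnA; congr (_ + _); rewrite big1 ?add0n; last first.
    by move=> c /andP[_]; rewrite eq_sym => /negPf->.
  by rewrite big1 // => j _; rewrite big1.
rewrite big_ord_recl [X in _ = _ + (X + _)]big1 => [|c _]; last by rewrite /= (negPf xS).
rewrite add0n /= xS mul1n (eq_bigr _ (fun z _ => IH z)) big_split /=; congr (_ + _).
rewrite exchange_big; apply: eq_bigr => j _ /=.
rewrite exchange_big; apply: eq_bigr => c _ /=.
by rewrite mul1n big_distrl /= /bump /= add1n subSS.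
Qed.

Lemma avoiding_conn S x y : x \notin S ->
  (y \in component (~: S) x) <-> exists n, avoiding S n x y != 0.
Proof.
move=> xS; split.
  rewrite inE => /connectP[p + ->] {y}.
  elim: p x xS => [|z p IH] x xS /=; first by exists 0; rewrite /= xS eqxx.
  case/andP=> /and3P[_ zS xz] /IH; rewrite inE in zS => /(_ zS)[n n0].
  by exists n.+1; rewrite /= xS mul1n (bigD1 z xz) /= addn_eq0 negb_and n0.
case=> n; elim: n x xS => [|n IH] x xS /=.
  by rewrite xS /=; case: (x =P y) => [-> _|//]; rewrite component_refl.
rewrite xS mul1n sum_nat_eq0 => /forall_inPn[z xz nz].
have zS : z \notin S by move: nz; case: (n) => [|?] /=; case: (z \notin S).
have zx : z \in component (~: S) x by apply: component_adj (component_refl _ _) _ _ xz; rewrite inE.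
by rewrite -(component_eq zx); apply: IH.
Qed.

(** Two names encode all separators of size at most 2: the empty set for [kappa = 0], [a] alone for
    1, both from 2 on. *)
Definition sep_set kappa a b :=
  [set x : V | (0 < kappa) && (x == a) || (1 < kappa) && (x == b)].

Lemma card_sep_set kappa a b : #|sep_set kappa a b| <= kappa.
Proof.
case: kappa => [|[|kappa]].
- by rewrite leqn0 cards_eq0; apply/eqP/setP=> x; rewrite !inE.
- apply: leq_trans (_ : #|[set a]| <= 1); last by rewrite cards1.
  by apply/subset_leq_card/subsetP=> x; rewrite !inE orbF.
apply: leq_trans (_ : #|[set a; b]| <= _); last by rewrite cards2; case: (a != b).
by apply/subset_leq_card/subsetP=> x; rewrite !inE.
Qed.

Lemma sep_set_ex (A : {set V}) (x0 : V) : #|A| <= 2 -> exists a b, sep_set #|A| a b = A.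
Proof.
case c: #|A| => [|[|[|//]]] _.
- exists x0, x0; apply/setP=> x; rewrite inE /=; move/eqP: c; rewrite cards_eq0 => /eqP->.
  by rewrite inE.
- move/eqP/cards1P: c => [a ->]; exists a, a; apply/setP=> x; by rewrite !inE orbF.
by move/eqP/cards2P: c => [a [b [_ ->]]]; exists a, b; apply/setP=> x; rewrite !inE.
Qed.

End Walks.

(** * Invariance of separators and ends under stable equivalence *)

Section Invariance.
Variable k : nat.
Hypothesis k_ge3 : 2 < k.
Local Notation E3 := (@E3 k _ _).
Local Notation E2 := (@E2 k _ _).
Local Notation E1 := (@E1 k _ _).
Implicit Types (G : graph).

Lemma E3_E2 G G' (l : arc_coloring G) (l' : arc_coloring G') a b c a' b' c' :
  E3 l l' a b c a' b' c' ->
  [/\ E2 l l' a b a' b', E2 l l' a c a' c', E2 l l' b c b' c' & E2 l l' c b c' b'].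
Proof.
move=> h; split; [exact: (E3_sel k_ge3 0 1 1 h)|exact: (E3_sel k_ge3 0 2 2 h)|
  exact: (E3_sel k_ge3 1 2 2 h)|exact: (E3_sel k_ge3 2 1 1 h)].
Qed.

Lemma E3_E1 G G' (l : arc_coloring G) (l' : arc_coloring G') a b c a' b' c' :
  E3 l l' a b c a' b' c' -> [/\ E1 l l' a a', E1 l l' b b' & E1 l l' c c'].
Proof.
move=> h; split; [exact: (E3_sel k_ge3 0 0 0 h)|exact: (E3_sel k_ge3 1 1 1 h)|
  exact: (E3_sel k_ge3 2 2 2 h)].
Qed.

Lemma E3_eqs G G' (l : arc_coloring G) (l' : arc_coloring G') a b c a' b' c' :
  E3 l l' a b c a' b' c' ->
  [/\ (a == b) = (a' == b'), (a == c) = (a' == c') & (b == c) = (b' == c')].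
Proof.
move=> /E3_E2[/(E3_atoms k_ge3)[-> _ _] /(E3_atoms k_ge3)[-> _ _] + _].
by case/(E3_atoms k_ge3) => ->.
Qed.

(** For [k = 3] a quadruple has no color of its own; the colors of its four triples take its
    place. *)
Definition E4 G G' (l : arc_coloring G) (l' : arc_coloring G') a b x y a' b' x' y' :=
  [/\ E3 l l' a b x a' b' x', E3 l l' a b y a' b' y', E3 l l' a x y a' x' y'
    & E3 l l' b x y b' x' y'].

(** One bijection answers in every slot, so a single move at a triple compares the new vertex with
    all pairs of old ones. *)
Lemma E3_E4 G G' (l : arc_coloring G) (l' : arc_coloring G') a b x a' b' x' :
  E3 l l' a b x a' b' x' -> exists f, [/\ bijective f,
    [/\ f a = a', f b = b' & f x = x'] & forall y, E4 l l' a b x y a' b' x' (f y)].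
Proof.
move=> h; have [f [bf fE fP]] := E3_step k_ge3 h; exists f; split=> // y.
have [h1 h2 h3] := fP y; split=> //; [exact: (E3_sel k_ge3 0 2 1 h2)|].
exact: (E3_sel k_ge3 1 2 0 h1).
Qed.

Lemma E1_bij G G' (l : arc_coloring G) (l' : arc_coloring G') x x' :
  E1 l l' x x' -> exists f, [/\ bijective f, f x = x' & forall y,
    E2 l l' x y x' (f y) /\ E1 l l' y (f y)].
Proof.
move=> /E3_E4[f [bf [fx _ _] fP]]; exists f; split=> // y.
by have [_ /E3_E2[_ ? _ _] /E3_E1[]] := fP y.
Qed.

Section Pair.
Variables (G G' : graph) (l : arc_coloring G) (l' : arc_coloring G').

Lemma walks_E n x y x' y' : E2 l l' x y x' y' -> walks n x y = walks n x' y'.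
Proof.
elim: n x x' => [|n IH] x x' h /=.
  by have [-> _ _] := E3_atoms k_ge3 h.
have [f [bf _ fP]] := E3_E4 h; rewrite (reindex f (onW_bij _ bf)) //=.
apply: eq_big => z.
  by have [_ _ /E3_E2[_ /(E3_atoms k_ge3)[]]] := fP z.
by move=> _; apply: IH; have [_ _ _ /E3_E2[]] := fP z.
Qed.

Lemma sep_set_E kappa a b x a' b' x' : E3 l l' a b x a' b' x' ->
  (x \in sep_set kappa a b) = (x' \in sep_set kappa a' b').
Proof. by case/E3_eqs=> _; rewrite !inE ![_ == x]eq_sym ![_ == x']eq_sym => -> ->. Qed.

Lemma first_hits_E kappa a b x a' b' x' c c' n : E3 l l' a b x a' b' x' ->
  c = a /\ c' = a' \/ c = b /\ c' = b' ->
  first_hits (sep_set kappa a b) c n x = first_hits (sep_set kappa a' b') c' n x'.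
Proof.
move=> + hc; elim: n x x' => [|n IH] x x' h /=.
  rewrite (sep_set_E _ h); have [_ ax bx] := E3_eqs h.
  by case: hc => -[-> ->]; rewrite ![x == _]eq_sym ![x' == _]eq_sym (ax, bx).
rewrite (sep_set_E _ h); congr (_ * _).
have [f [bf _ fP]] := E3_E4 h; rewrite [RHS](reindex f (onW_bij _ bf)) //=.
apply: eq_big => z.
  by have [_ _ /E3_E2[_ _ /(E3_atoms k_ge3)[]]] := fP z.
by move=> _; apply: IH; have [_] := fP z.
Qed.

(** Reachability off the separator is read off from the numbers of avoiding walks: all walks minus
    those that meet the separator. The latter combine first hits, given by the triple [a], [b], [x],
    with remaining walks, given by the pairs [a], [y] and [b], [y]. *)
Lemma component_sep_E kappa a b x y a' b' x' y' : E4 l l' a b x y a' b' x' y' ->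
  x \notin sep_set kappa a b ->
  (y \in component (~: sep_set kappa a b) x) = (y' \in component (~: sep_set kappa a' b') x').
Proof.
case=> abx aby axy bxy xS; have xS' := xS; rewrite (sep_set_E _ abx) in xS'.
have av n : avoiding (sep_set kappa a b) n x y = avoiding (sep_set kappa a' b') n x' y'.
  have [_ _ xy _] := E3_E2 axy; have := walks_E n xy.
  rewrite (walks_split (sep_set kappa a b)) (walks_split (sep_set kappa a' b') n x' y').
  set s := \sum_(j < n.+1) _; set s' := \sum_(j < n.+1) _.
  suff -> : s = s' by apply: addIn.
  apply: eq_bigr => j _; have [f [bf [fa fb _] fP]] := E3_E4 abx.
  rewrite [RHS](reindex f (onW_bij _ bf)) //=; apply: eq_big => c.
    by rewrite (sep_set_E _ (_ : E3 l l' a b c a' b' (f c))) //; have [] := fP c.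
  rewrite inE => hc; have {}hc : c = a \/ c = b.
    by case/orP: hc => /andP[_ /eqP]; [left|right].
  congr (_ * _); first by apply: first_hits_E => //; case: hc => ->; auto.
  by apply: walks_E; case: hc => ->; rewrite ?fa ?fb; [have [] := E3_E2 axy|have [] := E3_E2 bxy].
by apply/idP/idP => /avoiding_conn-/(_ _)[//|n n0]; apply/avoiding_conn => //;
  exists n; rewrite ?av // -av.
Qed.

Definition invariant (A : {set gV G}) (A' : {set gV G'}) :=
  forall x x', E1 l l' x x' -> (x \in A) = (x' \in A').

Lemma card_bij_set (f : gV G -> gV G') (A : {set gV G}) (A' : {set gV G'}) :
  bijective f -> (forall x, (x \in A) = (f x \in A')) -> #|A| = #|A'|.
Proof.
move=> bf h; rewrite -(card_imset A (bij_inj bf)); congr #|pred_of_set _|.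
apply/setP=> y; case: bf => g fK gK; rewrite -[y]gK (mem_imset _ _ (can_inj fK)).
exact: h.
Qed.

Lemma component_E (D : {set gV G}) (D' : {set gV G'}) x y x' y' : invariant D D' ->
  E2 l l' x y x' y' -> y \in component D x -> y' \in component D' x'.
Proof.
move=> DD' + yx; move: yx x'; rewrite inE => /connectP[p + ->] {y}.
elim: p x => [|z p IH] x /= => [_ x' /(E3_atoms k_ge3)[/esym]|].
  by rewrite eqxx => /eqP-> _ _; apply: component_refl.
case/andP=> /and3P[xD zD xz] /IH{}IH x' h.
have [f [_ _ fP]] := E3_E4 h; have [_ xyz _ /E3_E2[_ _ _ /IH]] := fP z.
have [_ /(E3_atoms k_ge3)[_ xz' _] _ _] := E3_E2 xyz.
have [/DD' Ex _ /DD' Ez] := E3_E1 xyz.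
have {}xz : f z \in component D' x'.
  by apply: component_adj (component_refl _ _) _ _ _; rewrite -?Ex -?Ez -?xz'.
by rewrite (component_eq xz).
Qed.

End Pair.

Lemma component_inv G G' (l : arc_coloring G) (l' : arc_coloring G')
    (D : {set gV G}) (D' : {set gV G'}) x y x' y' : invariant l l' D D' ->
  E2 l l' x y x' y' -> (y \in component D x) = (y' \in component D' x').
Proof.
move=> DD' xy; apply/idP/idP; first exact: component_E DD' xy.
apply: component_E (E3_sym xy) => z' z h; exact/esym/DD'/E3_sym.
Qed.

Lemma invariant_sym G G' (l : arc_coloring G) (l' : arc_coloring G') A A' :
  invariant l l' A A' -> invariant l' l A' A.
Proof. by move=> AA' x x' /E3_sym/AA'. Qed.

Lemma nb_component_inv G G' (l : arc_coloring G) (l' : arc_coloring G')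
    (D : {set gV G}) (D' : {set gV G'}) x y x' y' : invariant l l' D D' ->
  E2 l l' x y x' y' ->
  (y \in nb (component D x)) = (y' \in nb (component D' x')).
Proof.
move=> DD' xy; rewrite !inE -/(component D x) -/(component D' x').
rewrite -!(in_set (connect _ _)) -/(component D x) -/(component D' x').
rewrite (component_inv DD' xy); congr (_ && _).
have [f [bf _ fP]] := E3_E4 xy; have [g fK gK] := bf.
have key z : (z \in component D x) && gadj z y
    = (f z \in component D' x') && gadj (f z) y'.
  have [_ /E3_E2[_ xz zy zy'] _ _] := fP z.
  rewrite (component_inv DD' xz); have [_ /E3_E2[_ _ _]] := fP z.
  by case/(E3_atoms k_ge3)=> _ -> _.
apply/exists_inP/exists_inP => -[z zx zy].
  by move: (key z); rewrite zx zy => /esym/andP[]; exists (f z).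
by move: (key (g z)); rewrite gK zx zy => /andP[]; exists (g z).
Qed.

(** The end through [x], described by names of its separator, so that the color of the triple [a],
    [b], [x] decides every clause. *)
Definition piece_with G kappa m (M : {set gV G}) a b x :=
  [/\ x \notin sep_set kappa a b, #|sep_set kappa a b| = kappa,
      exists2 y, y \notin sep_set kappa a b & y \notin component (~: sep_set kappa a b) x,
      [disjoint component (~: sep_set kappa a b) x & M]
    & #|component (~: sep_set kappa a b) x| = m].

Lemma sep_frag G (S : {set gV G}) x y : x \notin S -> y \notin S ->
  y \notin component (~: S) x ->
  frag (component (~: S) x) /\ nb (component (~: S) x) \subset S.
Proof.
move=> xS yS yx; have nS : nb (component (~: S) x) \subset S.
  by rewrite -{2}[S]setCK; apply: nb_component; rewrite in_setC.
split=> //; apply/andP; split; apply/set0Pn; first by exists x; apply: component_refl.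
exists y; rewrite in_setC in_setU negb_or yx /=.
by apply: contra yS; apply: subsetP.
Qed.

Lemma piece_with_end G kappa m (M : {set gV G}) a b x :
  (forall A : {set gV G}, frag A -> kappa <= #|nb A|) ->
  piece_with kappa m M a b x ->
  is_end kappa m M (component (~: sep_set kappa a b) x).
Proof.
move=> km [xS cS [y yS yx] dM cm]; have [fK nK] := sep_frag xS yS yx.
rewrite /is_end fK dM cm eqxx andbT /= eqn_leq km // !andbT.
by apply: leq_trans (subset_leq_card nK) _; rewrite cS.
Qed.

Lemma end_piece_with G kappa m (M : {set gV G}) x :
  kappa <= 2 -> min_ends kappa m M -> x \in ends_union kappa m M ->
  exists a b, piece_with kappa m M a b x.
Proof.
move=> k2 minE /ends_unionP[K eK xK]; have cK := end_component minE eK xK.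
case/and4P: eK => /andP[_ /set0Pn[y yK]] /eqP nK dK /eqP mK.
have [|a [b]] := @sep_set_ex _ (nb K) x; first by rewrite nK.
rewrite nK => abK; exists a, b; rewrite /piece_with abK -cK; split=> //.
- by apply/negP=> /nbP[]; rewrite xK.
- by move: yK; rewrite in_setC in_setU negb_or => /andP[yK yn]; exists y.
Qed.

Lemma piece_with_E G G' (l : arc_coloring G) (l' : arc_coloring G') kappa m M M'
    a b x a' b' x' : invariant l l' M M' -> E3 l l' a b x a' b' x' ->
  piece_with kappa m M a b x -> piece_with kappa m M' a' b' x'.
Proof.
move=> MM' h [xS cS [y yS yx] dM cm].
have [f [bf _ fP]] := E3_E4 h.
have fS z : (z \in sep_set kappa a b) = (f z \in sep_set kappa a' b').
  by have [_ /(sep_set_E kappa)-> _ _] := fP z.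
have fK z : (z \in component (~: sep_set kappa a b) x) =
            (f z \in component (~: sep_set kappa a' b') x').
  by apply: component_sep_E xS.
split.
- by rewrite -(sep_set_E _ h).
- by rewrite -[RHS]cS; apply/esym/(card_bij_set bf fS).
- exists (f y); [by rewrite -fS | by rewrite -fK].
- apply/pred0P=> z' /=; have [g _ gK] := bf; rewrite -[z']gK -fK.
  have [_ /E3_E1[_ _ /MM' <-] _ _] := fP (g z'); exact: (pred0P dM).
- by rewrite -[RHS]cm; apply/esym/(card_bij_set bf fK).
Qed.

Lemma ends_union_E G G' (l : arc_coloring G) (l' : arc_coloring G') kappa m M M' x x' :
  kappa <= 2 -> invariant l l' M M' -> min_ends kappa m M ->
  (forall A : {set gV G'}, frag A -> kappa <= #|nb A|) -> E1 l l' x x' ->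
  x \in ends_union kappa m M -> x' \in ends_union kappa m M'.
Proof.
move=> k2 MM' minE km' xx' /(end_piece_with k2 minE)[a [b p]].
(* Pebble the separator [a], [b] in two moves while keeping [x]; the replies name the separator of
   an end through [x']. *)
have [f [_ [_ _ _] fP]] := E3_E4 xx'; have [_ xxa _ _] := fP a.
have [g [_ [_ _ _] gP]] := E3_E4 (E3_sel k_ge3 0 2 1 xxa).
have [_ xab _ _] := gP b; have abx := E3_sel k_ge3 1 2 0 xab.
have /(piece_with_end km') e := piece_with_E MM' abx p.
by apply/ends_unionP; eexists; [exact: e | apply: component_refl].
Qed.

(** Pebble a separator [a], [b] and vertices [x], [y] on its two sides, starting from the position
    [s]. The replies are separated too, and the component of the reply to [x] is the required
    fragment. *)
Lemma frag_transfer G G' (l : arc_coloring G) (l' : arc_coloring G') s s'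
    (K : {set gV G}) :
  E1 l l' s s' -> frag K -> #|nb K| <= 2 ->
  exists2 K' : {set gV G'}, frag K' & #|nb K'| <= #|nb K|.
Proof.
move=> ss' /andP[/set0Pn[x xK] /set0Pn[y yK]] n2.
have [a [b abK]] := sep_set_ex s n2.
have [f [_ [_ _ _] fP]] := E3_E4 ss'; have [_ ssa _ _] := fP a.
have [g [_ [_ _ _] gP]] := E3_E4 (E3_sel k_ge3 2 2 2 ssa).
have [_ aab _ _] := gP b.
have [h [_ [_ _ _] hP]] := E3_E4 (E3_sel k_ge3 0 2 2 aab).
have [_ abx _ _] := hP x.
have [j [_ [_ _ _] jP]] := E3_E4 abx.
move: yK; rewrite in_setC in_setU negb_or => /andP[yK yn].
have xn : x \notin nb K by apply/negP=> /nbP[]; rewrite xK.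
have xS : x \notin sep_set #|nb K| a b by rewrite abK.
have yx : y \notin component (~: sep_set #|nb K| a b) x.
  apply: contra yK => /(subsetP _); apply; rewrite abK.
  by apply: component_closed; rewrite ?setCK.
rewrite (component_sep_E (jP y) xS) in yx.
have [abx' aby' _ _] := jP y; rewrite (sep_set_E _ abx') in xS.
have yS : j y \notin sep_set #|nb K| (f a) (g b).
  by rewrite -(sep_set_E _ aby') abK.
have [fK' nK'] := sep_frag xS yS yx; exists (component (~: sep_set #|nb K| (f a) (g b)) (h x)) => //.
exact: leq_trans (subset_leq_card nK') (card_sep_set _ _ _).
Qed.

Lemma min_ends_ex G kappa (M A : {set gV G}) :
  (forall A : {set gV G}, frag A -> kappa <= #|nb A|) ->
  frag A -> #|nb A| = kappa -> [disjoint A & M] -> exists m, min_ends kappa m M.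
Proof.
move=> km fA nA dA.
pose P (B : {set gV G}) := [&& frag B, #|nb B| == kappa & [disjoint B & M]].
have PA : P A by rewrite /P fA nA eqxx.
have [B /and3P[fB nB dB] Bm] := arg_minnP (fun B : {set gV G} => #|B|) PA.
exists #|B|; split=> //; last by exists B; apply/and4P.
by move=> D fD /eqP nD dD; apply: Bm; apply/and3P.
Qed.

Lemma min_ends_transfer G G' (l : arc_coloring G) (l' : arc_coloring G') s s' kappa m M M' :
  kappa <= 2 -> E1 l l' s s' -> invariant l l' M M' ->
  min_ends kappa m M -> min_ends kappa m M'.
Proof.
move=> k2 ss' MM' /[dup] minE [km mm [K eK]].
have km' (A : {set gV G'}) : frag A -> kappa <= #|nb A|.
  move=> fA; rewrite leqNgt; apply/negP=> lt.
  have n2 : #|nb A| <= 2 by apply: leq_trans (ltnW lt) _.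
  have [B /km] := frag_transfer (E3_sym ss') fA n2.
  by move=> le1 le2; rewrite ltnNge (leq_trans le1 le2) in lt.
have [x xK] : exists x, x \in K by apply/set0Pn/(end_neq0 eK).
have [f [_ _ /(_ x)[_ xx']]] := E1_bij ss'.
have xD : x \in ends_union kappa m M by apply/ends_unionP; exists K.
have /ends_unionP[K' eK' _] := ends_union_E k2 MM' minE km' xx' xD.
have /and4P[fK' /eqP nK' dK' /eqP mK'] := eK'.
have [m' minE'] := min_ends_ex km' fK' nK' dK'.
(* [m'] is the minimum on the side of [G']. Moving an end in either direction gives one of the two
   inequalities. *)
suff <- : m' = m by [].
case: (minE') => _ mm' [L' eL']; have [x' xL'] : exists x', x' \in L'.
  exact/set0Pn/(end_neq0 eL').
have [h [_ _ /(_ x')[_ hx']]] := E1_bij (E3_sym ss').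
have xD' : x' \in ends_union kappa m' M' by apply/ends_unionP; exists L'.
have /ends_unionP[L eL _] := ends_union_E k2 (invariant_sym MM') minE' km hx' xD'.
apply/eqP; rewrite eqn_leq; apply/andP; split.
  by rewrite -mK'; apply: mm'.
by case/and4P: eL => fL /eqP nL dL /eqP <-; apply: mm.
Qed.

Lemma ends_union_inv G G' (l : arc_coloring G) (l' : arc_coloring G') s s' kappa m M M' :
  kappa <= 2 -> E1 l l' s s' -> invariant l l' M M' -> min_ends kappa m M ->
  invariant l l' (ends_union kappa m M) (ends_union kappa m M').
Proof.
move=> k2 ss' MM' minE x x' xx'; have minE' := min_ends_transfer k2 ss' MM' minE.
apply/idP/idP; first by apply: ends_union_E xx' => //; case: minE'.
by apply: ends_union_E (E3_sym xx') => //; [apply: invariant_sym | case: minE].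
Qed.

End Invariance.

(** * Matching blocks by counting points *)

Section Matching.

(** The zigzag condition makes [R] a matching of classes; a class is numbered by the position in
    [enum B] of its first member. *)
Lemma difunctional_coloring (A B : finType) (R : A -> B -> Prop) :
  (forall a1 b1 a2 b2, R a1 b1 -> R a2 b1 -> R a2 b2 -> R a1 b2) ->
  exists (mu : A -> nat) (mu' : B -> nat), forall a b, mu a = mu' b <-> R a b.
Proof.
move=> zigzag; pose Rb a b := `[< R a b >].
pose mu a := find (Rb a) (enum B).
(* The default [#|B|.+1], for elements related to nothing, exceeds every [mu a], which is at most
   [#|B|]. *)
pose mu' b := if [exists a, Rb a b]
  then find (fun b0 => [exists a, Rb a b && Rb a b0]) (enum B) else #|B|.+1.
exists mu, mu' => a b; split; last first.
  move=> ab; rewrite /mu /mu' ifT; last by apply/existsP; exists a; apply/asboolP.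
  apply: eq_find => b0; apply/idP/existsP => [ab0|[a1 /andP[/asboolP a1b /asboolP a1b0]]].
    by exists a; rewrite ab0 andbT; apply/asboolP.
  by apply/asboolP; apply: zigzag ab a1b a1b0.
rewrite /mu /mu'; case: ifP => [/existsP[a1 a1b]|_]; last first.
  move=> h; have := find_size (Rb a) (enum B).
  by rewrite h -cardE ltnn.
set P := fun b0 => _; move=> h; have hP : has P (enum B).
  by apply/hasP; exists b; rewrite ?mem_enum //; apply/existsP; exists a1; rewrite a1b.
have := nth_find b hP; have hR : has (Rb a) (enum B) by rewrite has_find h -has_find.
have := nth_find b hR; rewrite h => /asboolP ab0 /existsP[a2 /andP[/asboolP a2b /asboolP a2b0]].
exact: zigzag ab0 a2b0 a2b.
Qed.

(** Send an element to the one of equal rank in the equally large color class of [P']; [b0] is the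
    default of [nth]. *)
Lemma color_injection (A B : finType) (P : {set A}) (P' : {set B}) (b0 : B)
    (c : A -> nat) (c' : B -> nat) :
  (forall n, #|[set a in P | c a == n]| = #|[set b in P' | c' b == n]|) ->
  exists g : A -> B, {in P &, injective g} /\ {in P, forall a, g a \in P' /\ c' (g a) = c a}.
Proof.
move=> cE; pose As n := enum [set a in P | c a == n].
pose Bs n := enum [set b in P' | c' b == n].
have sE n : size (As n) = size (Bs n) by rewrite -!cardE.
pose g a := nth b0 (Bs (c a)) (index a (As (c a))).
have iA a : a \in P -> index a (As (c a)) < size (Bs (c a)).
  by move=> aP; rewrite -sE index_mem mem_enum inE aP eqxx.
have gP a : a \in P -> g a \in P' /\ c' (g a) = c a.
  move=> aP; have := mem_nth b0 (iA a aP); rewrite mem_enum inE.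
  by case/andP=> ? /eqP.
exists g; split=> // a1 a2 a1P a2P e.
have ec : c a1 = c a2 by have [_ <-] := gP _ a1P; have [_ <-] := gP _ a2P; rewrite e.
move: e; rewrite /g ec => /eqP; rewrite nth_uniq ?enum_uniq ?iA //; last by rewrite -ec iA.
have in1 : a1 \in As (c a2) by rewrite mem_enum inE a1P ec eqxx.
have in2 : a2 \in As (c a2) by rewrite mem_enum inE a2P eqxx.
by move/eqP=> h; rewrite -(nth_index a1 in1) h nth_index.
Qed.

(* Matched blocks have the same size, so the numbers of blocks of each type can
   be compared by counting points. *)
Lemma block_matching (T T' : finType) (D : {set T}) (D' : {set T'})
    (B : T -> {set T}) (B' : T' -> {set T'}) (I : {set T} -> {set T'} -> Prop)
    (F : T -> T') :
  (forall x, x \in D -> x \in B x /\ B x \subset D) ->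
  (forall x, x \in D' -> x \in B' x /\ B' x \subset D') ->
  (forall x y, y \in B x -> B y = B x) ->
  (forall x y, y \in B' x -> B' y = B' x) ->
  (forall K1 K1' K2 K2', I K1 K1' -> I K2 K1' -> I K2 K2' -> I K1 K2') ->
  (forall K K', I K K' -> #|K| = #|K'|) ->
  bijective F -> (forall x, (x \in D) = (F x \in D')) ->
  (forall x, x \in D -> I (B x) (B' (F x))) ->
  exists g : {set T} -> {set T'}, {in B @: D &, injective g} /\
    {in B @: D, forall K, g K \in B' @: D' /\ I K (g K)}.
Proof.
move=> Bx B'x Beq B'eq Idif Icard bF DF IF.
have [c [c' cP]] := difunctional_coloring Idif.
have cF x : x \in D -> c (B x) = c' (B' (F x)) by move=> xD; apply/cP/IF.
(* The points in blocks of color [n] are as many as these blocks times their common size [s]. *)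
have count (U : finType) (E : {set U}) (Bl : U -> {set U}) (cc : {set U} -> nat) n s :
    (forall x, x \in E -> x \in Bl x /\ Bl x \subset E) ->
    (forall x y, y \in Bl x -> Bl y = Bl x) ->
    (forall K, K \in Bl @: E -> cc K = n -> #|K| = s) ->
    #|[set x in E | cc (Bl x) == n]| = #|[set K in Bl @: E | cc K == n]| * s.
  move=> Blx Bleq sz; rewrite -sum1_card (partition_big Bl (mem [set K in Bl @: E | cc K == n])).
    rewrite -sum_nat_const; apply: eq_bigr => K hK.
    have /setIdP[KE /eqP cK] : K \in [set K in Bl @: E | cc K == n] by [].
    rewrite sum1_card -(sz _ KE cK); apply: eq_card => x.
    case/imsetP: KE => y yE eK; rewrite unfold_in /= inE.
    apply/andP/idP => [[/andP[xE _] /eqP<-]|xK]; first by case: (Blx _ xE).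
    have e : Bl x = K by rewrite eK; apply: Bleq; rewrite -eK.
    have [_ sub] := Blx _ yE; rewrite e cK !eqxx andbT; split=> //.
    by apply: (subsetP sub); rewrite -eK.
  by move=> x; rewrite !inE => /andP[xE ->]; rewrite imset_f.
have [|g [ginj gP]] := @color_injection _ _ (B @: D) (B' @: D') set0 c c'; last first.
  exists g; split=> // K /gP[gK cK]; split=> //; exact/cP.
move=> n; have Dn : #|[set x in D | c (B x) == n]| = #|[set x in D' | c' (B' x) == n]|.
  rewrite -(card_imset _ (bij_inj bF)); congr #|pred_of_set _|; apply/setP=> y.
  have [G FK GK] := bF; rewrite -[y]GK (mem_imset _ _ (can_inj FK)) !inE -DF.
  by case: (boolP (G y \in D)) => //= /cF->.
have [e0|[K0]] := set_0Vmem [set K in B @: D | c K == n].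
  have [e0'|[K0']] := set_0Vmem [set K in B' @: D' | c' K == n]; first by rewrite e0 e0' !cards0.
  rewrite inE => /andP[/imsetP[x xD' eK0] cK0'].
  move: Dn; have -> : [set x in D | c (B x) == n] = set0.
    apply/setP=> y; rewrite !inE; apply/negP=> /andP[yD cy].
    suff : B y \in set0 by rewrite inE.
    by rewrite -e0 inE imset_f.
  rewrite cards0 => /esym/eqP; rewrite cards_eq0 => /eqP e.
  suff : x \in set0 by rewrite inE.
  by rewrite -e inE xD' -eK0.
rewrite inE => /andP[/imsetP[x xD eK0] /eqP cK0].
have szD K : K \in B @: D -> c K = n -> #|K| = #|K0|.
  move=> _ cK; have IK0 := IF x xD; rewrite (Icard _ _ (_ : I K0 (B' (F x)))) ?eK0 //.
  by apply: Icard; apply/cP; rewrite cK -cF // -eK0.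
have szD' K : K \in B' @: D' -> c' K = n -> #|K| = #|K0|.
  by move=> _ cK; apply/esym/Icard/cP; rewrite cK.
(* The common size is positive, so it cancels from the two point counts, which agree by [Dn]. *)
have K0gt : 0 < #|K0| by rewrite eK0; apply/card_gt0P; exists x; case: (Bx _ xD).
apply/eqP; rewrite -(eqn_pmul2r K0gt); apply/eqP.
by rewrite -(count _ D B c n) // -(count _ D' B' c' n).
Qed.

Lemma bij_restrict (T T' : finType) (A : {set T}) (A' : {set T'}) (f : T -> T') :
  bijective f -> (forall x, (x \in A) = (f x \in A')) ->
  exists g : {x | x \in A} -> {x | x \in A'}, bijective g /\ forall u, val (g u) = f (val u).
Proof.
move=> [f' fK f'K] Af.
have mf (u : {x | x \in A}) : f (val u) \in A' by rewrite -Af (valP u).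
have mf' (u : {x | x \in A'}) : f' (val u) \in A by rewrite Af f'K (valP u).
exists (fun u => Sub (f (val u)) (mf u)); split=> [|u]; last exact: SubK.
exists (fun u => Sub (f' (val u)) (mf' u)) => u; apply: val_inj => /=; [exact: fK | exact: f'K].
Qed.

End Matching.

(** * Torsos as minors *)

Section Torso.
Variable G : graph.
Local Notation V := (gV G).
Implicit Types (A D K : {set V}) (F : {set {set V}}).

(** Turns every set of [F] into a clique; for an attachment set of two vertices this adds the
    virtual edge. *)
Definition aug F : rel V :=
  fun x y => gadj x y || (x != y) && [exists N in F, (x \in N) && (y \in N)].

Lemma aug_sym F : symmetric (aug F).
Proof.
move=> x y; rewrite /aug gadj_sym [x == y]eq_sym; congr (_ || _ && _).
by apply: eq_existsb => N; rewrite [(x \in N) && _]andbC.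
Qed.

Lemma aug_irr F : irreflexive (aug F).
Proof. by move=> x; rewrite /aug gadj_irr eqxx. Qed.

Definition torso A F : graph :=
  @Graph {x | x \in A} [rel u v | aug F (val u) (val v)]
    (fun u v => aug_sym F (val u) (val v)) (fun u => aug_irr F (val u)).

Lemma connect_component D A x y : x \in D -> component D x \subset A ->
  y \in component D x -> connect (restr A) x y.
Proof.
move=> xD sA yx; suff : y \in component A x :&: component D x.
  by case/setIP; rewrite inE.
apply: (subsetP (component_closed _ _)) yx; first by rewrite inE !component_refl.
apply/subsetP=> v /nbP[vI [z /setIP[zA zD] zv]]; rewrite inE.
apply: contra vI => vD; have zD' := subsetP (component_sub xD) _ zD.
have vx := component_adj zD zD' vD zv.
by rewrite inE vx andbT; apply: (component_adj zA); rewrite // (subsetP sA).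
Qed.

Lemma connect_hub A u : (forall x, x \in A -> connect (restr A) x u) ->
  forall x y, x \in A -> y \in A -> connect (restr A) x y.
Proof.
move=> Au x y /Au xu /Au yu; apply: connect_trans xu _.
by rewrite (sym_connect_sym (restr_sym A)).
Qed.

Lemma connect_component_hub D A x u v : x \in D -> component D x \subset A ->
  u \in A -> v \in component D x -> gadj v u -> connect (restr A) x u.
Proof.
move=> xD sA uA vx vu; apply: connect_trans (connect_component xD sA vx) (connect1 _).
by rewrite /restr /= uA vu (subsetP sA).
Qed.

Lemma pair_cover (N : {set V}) u v w : #|N| <= 2 -> u \in N -> v \in N -> u != v ->
  w \in N -> w = u \/ w = v.
Proof.
move=> N2 uN vN uv wN; case: (eqVneq w u) => [|wu]; first by left.
case: (eqVneq w v) => [|wv]; first by right.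
have : #|[set u; v] :|: [set w]| <= #|N|.
  by apply/subset_leq_card; rewrite !subUset !sub1set uN vN.
rewrite setUC cardsU1 cards2 uv !inE negb_or wu wv /= => h.
by have := leq_trans h N2.
Qed.

Lemma augE F x y : aug F x y =
  gadj x y || (x != y) && [exists N in F, (x \in N) && (y \in N)].
Proof. by []. Qed.

(* Each component of [D] is contracted into one of its attachment vertices. *)
Lemma torso_minor_delete D :
  (forall x, x \in D -> #|nb (component D x)| <= 2) ->
  is_minor (torso (~: D) [set nb (component D x) | x in D]) G.
Proof.
(* [rep] depends only on the attachment set, so a whole component goes to one vertex; a component
   without attachments goes nowhere. *)
move=> nD; pose rep x := [pick y in nb (component D x)].
have repE x y : y \in component D x -> rep y = rep x by move=> /component_eq; rewrite /rep => ->.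
pose phi (u : {x | x \in ~: D}) := val u |: [set x in D | rep x == Some (val u)].
have uD (u : {x | x \in ~: D}) : val u \notin D by have := valP u; rewrite inE.
have phiu u : val u \in phi u by rewrite setU11.
have sphi u x : x \in D -> rep x = Some (val u) -> component D x \subset phi u.
  move=> xD rx; apply/subsetP=> y yx; rewrite !inE.
  by rewrite (subsetP (component_sub xD) _ yx) (repE _ _ yx) rx eqxx orbT.
exists phi; split.
- by move=> u; apply/set0Pn; exists (val u).
- move=> u v uv; rewrite disjoints_subset; apply/subsetP=> z; rewrite !inE negb_or negb_and.
  case/predU1P=> [->|/andP[zD /eqP->]]; first by rewrite (uD u) /= andbT.
  rewrite zD /= -[Some _ == _]/(val u == val v) (inj_eq val_inj) uv andbT.
  by apply/eqP=> e; have := uD v; rewrite (_ : val v = z) // zD.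
- move=> u; apply: (@connect_hub _ (val u)) => x /setU1P[->|]; first exact: connect0.
  rewrite inE => /andP[xD /eqP rx]; have sx := sphi _ _ xD rx.
  move: rx; rewrite /rep; case: pickP => // y /nbP[_ [z zx zy]] [e].
  rewrite e in zy; apply: connect_component_hub zx zy => //; exact: phiu.
move=> u v; rewrite [gadj u v]augE => /orP[uv|/andP[uv]].
  by exists (val u), (val v).
case/exists_inP=> _ /imsetP[x xD ->] /andP[un vn].
have [w wn rx] : exists2 w, w \in nb (component D x) & rep x = Some w.
  by rewrite /rep; case: pickP => [w|/(_ (val u))]; [exists w | rewrite un].
case: (pair_cover (nD x xD) un vn uv wn) => e; rewrite {}e {w wn} in rx.
  case/nbP: vn => _ [z zx zv]; exists z, (val v); split=> //.
  exact: (subsetP (sphi _ _ xD rx)).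
case/nbP: un => _ [z zx zu]; exists (val u), z; split=> //; last by rewrite gadj_sym.
exact: (subsetP (sphi _ _ xD rx)).
Qed.

(* The virtual edge is realized by contracting a component on the far side. *)
Lemma torso_minor_piece K : #|nb K| <= 2 -> frag K ->
  (forall A, frag A -> #|nb K| <= #|nb A|) -> is_minor (torso (K :|: nb K) [set nb K]) G.
Proof.
move=> n2 /andP[/set0Pn[x0 x0K] /set0Pn[y0 y0K]] nmin.
pose L := component (co K) y0; have Lco : L \subset co K := component_sub y0K.
have x0L : x0 \in co L.
  by apply: (subsetP (co_sub Lco)); apply: (subsetP (co_co K)).
(* [nb L] lies in [nb K] and is no smaller, by the minimality of [nb K]. So [L] touches every
   attachment vertex. *)
have nL : nb L = nb K.
  apply/eqP; rewrite eqEcard nmin ?andbT; last first.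
    rewrite /frag; apply/andP; split; apply/set0Pn; last by exists x0.
    by exists y0; apply: component_refl.
  apply/subsetP=> y /[dup] ynL /nbP[_ [z zL zy]].
  apply: (subsetP (nb_co K)); apply: mem_nb zy _; first exact: (subsetP Lco).
  by have := subsetP (nb_component y0K) _ ynL; rewrite inE.
have LA x : x \in L -> x \notin K :|: nb K by move/(subsetP Lco); rewrite inE.
pose rep := [pick y in nb K].
pose phi (u : {x | x \in K :|: nb K}) :=
  val u |: (if rep == Some (val u) then L else set0).
have phiu u : val u \in phi u by rewrite setU11.
exists phi; split.
- by move=> u; apply/set0Pn; exists (val u).
- move=> u v uv; rewrite disjoints_subset; apply/subsetP=> z; rewrite in_setC.
  case/setU1P=> [->|zL].
    rewrite in_setU1 negb_or (inj_eq val_inj) uv /=; case: ifP => _; last by rewrite inE.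
    by apply/negP=> /LA; rewrite (valP u).
  move: zL; case: ifP => [/eqP ru zL|_]; last by rewrite inE.
  rewrite in_setU1 negb_or ru -[Some _ == _]/(val u == val v) (inj_eq val_inj) (negPf uv).
  by rewrite inE andbT; apply: contraNneq (LA _ zL) => ->; apply: valP.
- move=> u; apply: (@connect_hub _ (val u)) => x /setU1P[->|xL]; first exact: connect0.
  have ru : rep = Some (val u) by move: xL; case: ifP => [/eqP//|]; rewrite inE.
  have un : val u \in nb L.
    by move: ru; rewrite nL /rep; case: pickP => // y yn [e]; rewrite -[val u]e.
  have eL : phi u = val u |: L by rewrite /phi ru eqxx.
  rewrite ru eqxx in xL; case/nbP: un => _ [z zL zu].
  have sx : component (co K) x \subset phi u by rewrite (component_eq xL) eL subsetUr.
  apply: connect_component_hub sx (phiu u) _ zu; first exact: (subsetP Lco).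
  by rewrite (component_eq xL).
have key (u v : {x | x \in K :|: nb K}) : rep = Some (val u) -> val v \in nb K ->
    exists x y, [/\ x \in phi u, y \in phi v & gadj x y].
  move=> ru vn; have : val v \in nb L by rewrite nL.
  case/nbP=> _ [z zL zv]; exists z, (val v); split=> //.
  by rewrite /phi ru eqxx inE zL orbT.
move=> u v; rewrite [gadj u v]augE => /orP[uv|/andP[uv]].
  by exists (val u), (val v).
case/exists_inP=> _ /set1P-> /andP[un vn].
have [w wn rw] : exists2 w, w \in nb K & rep = Some w.
  by rewrite /rep; case: pickP => [w|/(_ (val u))]; [exists w | rewrite un].
case: (pair_cover n2 un vn uv wn) => e; rewrite {}e {w wn} in rw; first exact: key.
have [x [y [? ? xy]]] := key v u rw un; exists y, x; split=> //; by rewrite gadj_sym.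
Qed.

Lemma card_torso A F : #|gV (torso A F)| = #|A|.
Proof. by rewrite /= card_sig; apply: eq_card => x; rewrite unfold_in. Qed.

End Torso.

(** * The bijective game restricted to torsos *)

Section TorsoGame.
Variable k : nat.
Hypothesis k_ge3 : 2 < k.
Variables (G G' : graph) (A : {set gV G}) (A' : {set gV G'}).
Variables (F : {set {set gV G}}) (F' : {set {set gV G'}}).
Variables (mu : arc_coloring G) (mu' : arc_coloring G').

Definition torso_col (H : graph) (B : {set gV H}) (E : {set {set gV H}})
  (c : arc_coloring H) : arc_coloring (torso B E) := fun u v => c (val u) (val v).

Definition in_set_tuple (H : graph) (B : {set gV H}) (t : ktuple k H) :=
  forall i, t i \in B.

Definition val_tuple (H : graph) (B : {set gV H}) (E : {set {set gV H}})
  (t : ktuple k (torso B E)) : ktuple k H := [ffun i => val (t i)].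

(** Strategies live on tuples of the ambient graphs, so that [R] can use facts not visible in the
    torso. Bijections matching [A] with [A'] restrict to the torsos. *)
Lemma torso_stable (R : ktuple k G -> ktuple k G' -> Prop) :
  (forall t t', in_set_tuple A t -> in_set_tuple A' t' -> R t t' -> forall i j,
     [/\ (t i == t j) = (t' i == t' j), aug F (t i) (t j) = aug F' (t' i) (t' j)
       & (t i == t j) || aug F (t i) (t j) -> mu (t i) (t j) = mu' (t' i) (t' j)]) ->
  (forall t t', in_set_tuple A t -> in_set_tuple A' t' -> R t t' ->
     exists f, [/\ bijective f, forall x, (x \in A) = (f x \in A')
       & forall w i, w \in A -> R (upd t i w) (upd t' i (f w))]) ->
  forall (t : ktuple k (torso A F)) (t' : ktuple k (torso A' F')),
    R (val_tuple t) (val_tuple t') ->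
    stable_eq (@torso_col G A F mu) (@torso_col G' A' F' mu') t t'.
Proof.
move=> Ra Rs; apply: simulation_stable => t t' tt'.
  have tA : in_set_tuple A (val_tuple t) by move=> i; rewrite ffunE; apply: valP.
  have tA' : in_set_tuple A' (val_tuple t') by move=> i; rewrite ffunE; apply: valP.
  by move=> i j; have := Ra _ _ tA tA' tt' i j; rewrite !ffunE.
have tA : in_set_tuple A (val_tuple t) by move=> i; rewrite ffunE; apply: valP.
have tA' : in_set_tuple A' (val_tuple t') by move=> i; rewrite ffunE; apply: valP.
have [f [bf Af fP]] := Rs _ _ tA tA' tt'.
have [g [bg gE]] := bij_restrict bf Af; exists g; split=> // w i.
have e (H : graph) (B : {set gV H}) (E : {set {set gV H}}) (u : ktuple k (torso B E)) x :
    val_tuple (upd u i x) = upd (val_tuple u) i (val x).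
  by apply/ffunP=> j; rewrite !ffunE; case: ifP.
by rewrite !e gE; apply/fP/(valP w).
Qed.

Lemma torso_iso (phi : gV (torso A F) -> gV (torso A' F')) (x0' : gV G') :
  acol_iso (@torso_col G A F mu) (@torso_col G' A' F' mu') phi ->
  exists psi : gV G -> gV G', [/\ forall u, psi (val u) = val (phi u),
    forall x, x \in A -> psi x \in A', {in A &, injective psi},
    forall x y, x \in A -> y \in A -> aug F' (psi x) (psi y) = aug F x y
  & forall x y, x \in A -> y \in A -> (x == y) || aug F x y -> mu x y = mu' (psi x) (psi y)].
Proof.
case=> bphi phia phi1 phi2.
pose psi x := if insub x is Some u then val (phi u) else x0'.
have psiE (u : {x | x \in A}) : psi (val u) = val (phi u) by rewrite /psi valK.
have AE x : x \in A -> exists u : {x | x \in A}, x = val u.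
  by move=> xA; exists (Sub x xA); rewrite SubK.
exists psi; split=> // [x|x y|x y|x y].
- by case/AE=> u ->; rewrite psiE; apply: valP.
- by case/AE=> u -> /AE[v ->]; rewrite !psiE => /val_inj/(bij_inj bphi)->.
- by case/AE=> u -> /AE[v ->]; rewrite !psiE; apply: phia.
case/AE=> u -> /AE[v ->]; rewrite !psiE (inj_eq val_inj) => /predU1P[<-|].
  exact: phi1.
exact: phi2.
Qed.

End TorsoGame.

(** * Transfer of equivalence to the torsos *)

Section Transfer.
Variable k : nat.
Hypothesis k_ge3 : 2 < k.
Local Notation E3 := (@E3 k _ _).
Local Notation E2 := (@E2 k _ _).
Local Notation E1 := (@E1 k _ _).
Local Notation invariant := (invariant k).

Section Pair.
Variables (G G' : graph) (l : arc_coloring G) (l' : arc_coloring G').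

(** Coloring torsos by these classes makes their isomorphisms carry colored pairs to [E2]-equivalent
    pairs of the ambient graphs, so real and virtual edges stay distinguished. *)
Lemma pair_coloring (N : {set gV G}) (N' : {set gV G'}) :
  exists (mu : arc_coloring G) (mu' : arc_coloring G'), forall x y x' y',
    mu x y = mu' x' y' <->
    [/\ E2 l l' x y x' y', (x \in N) = (x' \in N') & (y \in N) = (y' \in N')].
Proof.
pose R (p : gV G * gV G) (q : gV G' * gV G') :=
  [/\ E2 l l' p.1 p.2 q.1 q.2, (p.1 \in N) = (q.1 \in N') & (p.2 \in N) = (q.2 \in N')].
have [|mu [mu' muP]] := @difunctional_coloring _ _ R.
  move=> p1 q1 p2 q2 [e11 x11 y11] [e21 x21 y21] [e22 x22 y22]; split.
  - exact: stable_eq_trans (stable_eq_trans e11 (stable_eq_sym e21)) e22.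
  - by rewrite x11 -x21.
  - by rewrite y11 -y21.
by exists (fun x y => mu (x, y)), (fun x y => mu' (x, y)) => x y x' y'; apply: muP.
Qed.

Variables (D : {set gV G}) (D' : {set gV G'}).
Hypothesis DD' : invariant l l' D D'.

Definition attachments (H : graph) (B : {set gV H}) := [set nb (component B x) | x in B].

(** A virtual edge is witnessed by a vertex [z] of [D]; the bijection of a move at [x], [y] carries
    witnesses to witnesses. *)
Lemma aug_attachments_E x y x' y' : E2 l l' x y x' y' ->
  aug (attachments D) x y = aug (attachments D') x' y'.
Proof.
move=> xy; have [exy axy _] := E3_atoms k_ge3 xy; rewrite !augE exy axy.
congr (_ || _ && _); have [f [bf _ fP]] := E3_E4 k_ge3 xy; have [g fK gK] := bf.
have key z : (z \in D) && ((x \in nb (component D z)) && (y \in nb (component D z)))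
  = (f z \in D') && ((x' \in nb (component D' (f z))) && (y' \in nb (component D' (f z)))).
  have [_ yz xz _] := fP z; have [_ _ /DD' ->] := E3_E1 k_ge3 yz.
  have [_ _ _ /(nb_component_inv k_ge3 DD')->] := E3_E2 k_ge3 yz.
  have h := E3_sel k_ge3 2 0 0 xz.
  by rewrite (nb_component_inv k_ge3 DD' h).
apply/exists_inP/exists_inP => -[_ /imsetP[z zD ->] xyz].
  by move: (key z); rewrite zD xyz => /esym/andP[fzD h]; exists (nb (component D' (f z))) => //; apply: imset_f.
by move: (key (g z)); rewrite gK zD xyz => /andP[gzD h]; exists (nb (component D (g z))) => //; apply: imset_f.
Qed.

Lemma torso_delete_stable (mu : arc_coloring G) (mu' : arc_coloring G') :
  (forall x y x' y', E2 l l' x y x' y' -> mu x y = mu' x' y') ->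
  forall (u : gV (torso (~: D) (attachments D))) (u' : gV (torso (~: D') (attachments D'))),
  E1 l l' (val u) (val u') -> vcolor_eq k (torso_col mu) (torso_col mu') u u'.
Proof.
move=> muP u u' uu'.
pose R (t : ktuple k G) (t' : ktuple k G') := stable_eq l l' t t'.
apply: (@torso_stable _ _ _ _ _ _ _ _ _ R).
- move=> t t' _ _ tt' i j.
  have e : E2 l l' (t i) (t j) (t' i) (t' j) := stable_eq_E3 k_ge3 i j j tt'.
  have [ex _ _] := E3_atoms k_ge3 e; split; rewrite ?ex //.
    exact: aug_attachments_E.
  by move=> _; apply: muP.
- move=> t t' _ _ tt'; have [f [bf fP]] := stable_eq_step tt'; exists f; split=> // [x|w i _]; last exact: fP.
  rewrite !inE; congr (~~ _); apply: DD'.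
  have := stable_eq_E3 k_ge3 (slot0 k_ge3) (slot0 k_ge3) (slot0 k_ge3) (fP x (slot0 k_ge3)).
  by rewrite !updE eqxx.
apply: (stable_eq_covered k_ge3 uu') => i; exists (slot0 k_ge3).
by rewrite !ffunE.
Qed.

(* Positions in which a vertex of the piece [K] is pebbled: it determines [K]. *)
Definition linked (K : {set gV G}) (K' : {set gV G'}) (u : ktuple k G) (u' : ktuple k G') :=
  stable_eq l l' u u' /\ exists j, u j \in K /\ u' j \in K'.

Section Piece.
Variables (w0 : gV G) (w0' : gV G').
Local Notation K := (component D w0).
Local Notation K' := (component D' w0').
Local Notation A := (K :|: nb K).
Local Notation A' := (K' :|: nb K').

Lemma linked_mem u u' i : linked K K' u u' ->
  (u i \in K) = (u' i \in K') /\ (u i \in nb K) = (u' i \in nb K').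
Proof.
case=> uu' [j [jK jK']]; have e : E2 l l' (u j) (u i) (u' j) (u' i).
  exact: (stable_eq_E3 k_ge3 j i i uu').
rewrite -(component_eq jK) -(component_eq jK'); split.
  exact: (component_inv k_ge3 DD' e).
exact: (nb_component_inv k_ge3 DD' e).
Qed.

Lemma linked_step u u' : linked K K' u u' ->
  exists f, [/\ bijective f, forall w i, stable_eq l l' (upd u i w) (upd u' i (f w))
    & forall w, (w \in K) = (f w \in K') /\ (w \in nb K) = (f w \in nb K')].
Proof.
case=> uu' [j [jK jK']]; have [f [bf fP]] := stable_eq_step uu'; exists f; split=> // w.
have [i ij] := other_slot k_ge3 j.
have /(linked_mem i) : linked K K' (upd u i w) (upd u' i (f w)).
  by split=> //; exists j; rewrite !updE eq_sym (negPf ij).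
by rewrite !updE eqxx.
Qed.

Hypothesis nK_le2 : #|nb K| <= 2.

Lemma third_slot (i j : 'I_k) : exists m, m != i /\ m != j.
Proof.
have [m mP] := free_slot k_ge3 (fun x : 'I_k => if x == slot0 k_ge3 then i else j) (slot2 k_ge3).
exists m; split.
  by have := mP (slot0 k_ge3) isT; rewrite eqxx eq_sym.
by have := mP (slot1 k_ge3) isT; rewrite /= eq_sym.
Qed.

(* If all pebbles sit on the at most two attachment vertices, a third slot
   remains for remembering the piece. *)
Lemma linked_upd u u' f (t : ktuple k G) (t' : ktuple k G') w i :
  (forall w i, stable_eq l l' (upd u i w) (upd u' i (f w))) ->
  (forall w, (w \in K) = (f w \in K') /\ (w \in nb K) = (f w \in nb K')) ->
  (forall i, t i \in A) -> w \in A -> linked K K' u u' -> covered t t' u u' ->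
  exists u1 u1', linked K K' u1 u1' /\ covered (upd t i w) (upd t' i (f w)) u1 u1'.
Proof.
move=> fP fK tA wA lk cov; have [uu' [j [jK jK']]] := lk.
have [p pP] := fin_all_exists cov.
suff [m [cv [q [qK qK']]]] : exists m,
    (forall n, n != i -> exists q, t n = upd u m w q /\ t' n = upd u' m (f w) q) /\
    exists q, upd u m w q \in K /\ upd u' m (f w) q \in K'.
  exists (upd u m w), (upd u' m (f w)); split; first by split=> //; exists q.
  move=> n; case: (eqVneq n i) => [->|ni].
    by exists m; rewrite !updE !eqxx.
  by have [q1 q1P] := cv n ni; exists q1; rewrite !updE (negPf ni) -!updE.
have [m mP] := free_slot k_ge3 p i.
have cvm n : n != i -> exists q, t n = upd u m w q /\ t' n = upd u' m (f w) q.
  by move=> ni; exists (p n); rewrite !updE (negPf (mP n ni)); apply: pP.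
have [wK|wK] := boolP (w \in K).
  exists m; split=> //; exists m; rewrite !updE eqxx; split=> //.
  by have [<-] := fK w.
have [/existsP[n /andP[ni nK]]|/existsPn noK] := boolP [exists n, (n != i) && (t n \in K)].
  exists m; split=> //; exists (p n); rewrite !updE (negPf (mP n ni)).
  have [e1 e2] := pP n; rewrite -e1 -e2; split=> //.
  by have [+ _] := linked_mem (p n) lk; rewrite -e1 -e2 nK.
have wN : w \in nb K by move: wA; rewrite in_setU (negPf wK).
have tN n : n != i -> t n \in nb K.
  by move=> ni; have := tA n; have := noK n; rewrite ni /= in_setU => /negPf->.
(* Here [w] and all kept pebbles of [t] are among at most two attachment vertices, so apart from [w]
   they are found in one slot [q] of [u]. Placing [w] in a slot other than [q] and [j] preserves the
   pebble in [K]. *)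
have [q qP] : exists q, forall n, n != i -> t n = w \/ t n = u q.
  have [/existsP[n /andP[ni nw]]|/existsPn now] := boolP [exists n, (n != i) && (t n != w)].
    exists (p n) => n1 n1i; have [<- _] := pP n; rewrite eq_sym in nw.
    exact: pair_cover nK_le2 wN (tN n ni) nw (tN n1 n1i).
  by exists j => n ni; left; apply/eqP; have := now n; rewrite ni negbK.
have [m2 [m2j m2q]] := third_slot j q; exists m2; split; last first.
  by exists j; rewrite !updE eq_sym (negPf m2j).
have fu x : f (u x) = u' x := stable_eq_step_val k_ge3 x fP.
move=> n ni; have [e1 e2] := pP n; have [tw|tq] := qP n ni.
  by exists m2; rewrite !updE eqxx e2 -fu -e1 tw.
by exists q; rewrite !updE eq_sym (negPf m2q) e2 -!fu -e1 tq.
Qed.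

(** A torso position is simulated by a linked position covering it, in which a pebble inside [K]
    survives even when the torso position has none there. *)
Lemma torso_piece_stable (mu : arc_coloring G) (mu' : arc_coloring G') :
  (forall x y x' y', E2 l l' x y x' y' -> (x \in nb K) = (x' \in nb K') ->
     (y \in nb K) = (y' \in nb K') -> mu x y = mu' x' y') ->
  forall u u' i (s : gV (torso A [set nb K])) (s' : gV (torso A' [set nb K'])),
  linked K K' u u' -> u i = val s -> u' i = val s' ->
  vcolor_eq k (torso_col mu) (torso_col mu') s s'.
Proof.
move=> muP u u' i s s' lk si si'.
pose R (t : ktuple k G) (t' : ktuple k G') :=
  exists u u', linked K K' u u' /\ covered t t' u u'.
apply: (@torso_stable _ _ _ _ _ _ _ _ _ R).
- move=> t t' _ _ [v [v' [{}lk cov]]] p q; have [p1 [-> ->]] := cov p; have [q1 [-> ->]] := cov q.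
  have e : E2 l l' (v p1) (v q1) (v' p1) (v' q1).
    by case: lk => + _; apply: (stable_eq_E3 k_ge3).
  have [e1 e2 _] := E3_atoms k_ge3 e.
  have [_ np] := linked_mem p1 lk; have [_ nq] := linked_mem q1 lk.
  split; first exact: e1.
    rewrite !augE e1 e2; congr (_ || _ && _).
    apply/exists_inP/exists_inP => -[_ /set1P->].
      by rewrite np nq; exists (nb K'); first exact: set11.
    by rewrite -np -nq; exists (nb K); first exact: set11.
  by move=> _; apply: muP.
- move=> t t' tA _ [v [v' [{}lk cov]]]; have [f [bf fP fK]] := linked_step lk.
  exists f; split=> // [x|w m wA]; first by rewrite !in_setU; have [-> ->] := fK x.
  exact: linked_upd fP fK tA wA lk cov.
by exists u, u'; split=> // n; exists i; rewrite si si' !ffunE.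
Qed.

End Piece.
End Pair.
End Transfer.

(** * Gluing *)

Section Gluing.
Variables (G G' : graph) (l : arc_coloring G) (l' : arc_coloring G').

(** Only the values of [psi] on [K :|: nb K] matter. Agreement with [h] on the attachments is what
    permits gluing; adjacency is that of the original graphs, without virtual edges. *)
Definition piece_iso (h : gV G -> gV G') (K : {set gV G}) (K' : {set gV G'})
    (psi : gV G -> gV G') : Prop :=
  [/\ h @: nb K = nb K', {in nb K, psi =1 h}, psi @: K = K', {in K &, injective psi}
    & forall x y, x \in K :|: nb K -> y \in K :|: nb K ->
      gadj (psi x) (psi y) = gadj x y /\
      ((x == y) || gadj x y -> l x y = l' (psi x) (psi y))].

(** Compose [psi1], the inverse of [psi2] and [psi3]. Injectivity of [h] off [D] gives [K1] and [K2]
    the same attachments. This is the zigzag condition of [block_matching]. *)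
Lemma piece_iso_zigzag (D : {set gV G}) h K1 K1' K2 K2' psi1 psi2 psi3 :
  {in ~: D &, injective h} -> nb K1 \subset ~: D -> nb K2 \subset ~: D ->
  piece_iso h K1 K1' psi1 -> piece_iso h K2 K1' psi2 -> piece_iso h K2 K2' psi3 ->
  exists psi, piece_iso h K1 K2' psi.
Proof.
move=> hinj n1D n2D [n11 h1 i1 inj1 a1] [n21 h2 i2 inj2 a2] [n22 h3 i3 inj3 a3].
have n12 : nb K1 = nb K2.
  have sub (S S' : {set gV G}) : S \subset ~: D -> S' \subset ~: D ->
      h @: S = h @: S' -> S \subset S'.
    move=> SD S'D e; apply/subsetP=> x xS.
    have : h x \in h @: S' by rewrite -e imset_f.
    case/imsetP=> y yS' /hinj-> //; [exact: (subsetP SD)|exact: (subsetP S'D)].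
  by apply/eqP; rewrite eqEsubset; apply/andP; split; apply: sub; rewrite // n11 n21.
have [inv invP] : exists inv : gV G -> gV G, forall x, x \in K1 -> inv x \in K2 /\ psi2 (inv x) = psi1 x.
  apply: (@fin_all_exists _ (fun=> gV G) (fun x y => x \in K1 -> y \in K2 /\ psi2 y = psi1 x)).
  move=> x; have [xK|xK] := boolP (x \in K1); last by exists x.
  have : psi1 x \in psi2 @: K2 by rewrite i2 -i1 imset_f.
  by case/imsetP=> y yK e; exists y.
pose psi x := if x \in K1 then psi3 (inv x) else h x.
have nK x (S : {set gV G}) : x \in nb S -> x \notin S by case/nbP.
have key x : x \in K1 :|: nb K1 -> exists2 y, y \in K2 :|: nb K2 & psi2 y = psi1 x /\ psi x = psi3 y.
  case/setUP=> xK.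
    have [yK e] := invP x xK; exists (inv x); first by rewrite inE yK.
    by rewrite /psi xK.
  exists x; first by rewrite in_setU -n12 xK orbT.
  by rewrite /psi (negPf (nK _ _ xK)) h1 // h2 ?h3 -?n12.
have e2 x y : x \in K2 :|: nb K2 -> y \in K2 :|: nb K2 -> psi2 x = psi2 y -> x = y.
  have out z z' : z \in K2 -> z' \in nb K2 -> psi2 z = psi2 z' -> False.
    move=> zK zN; have : psi2 z \in K1' by rewrite -i2 imset_f.
    have : psi2 z' \in nb K1' by rewrite h2 // -n21 imset_f.
    by move=> /nbP[+ _] => /negPf nz + e; rewrite e nz.
  move=> /setUP[xK|xN] /setUP[yK|yN]; first exact: inj2.
  - by move/(out _ _ xK yN).
  - by move/esym/(out _ _ yK xN).
  by rewrite !h2 // => /hinj; apply; apply: (subsetP n2D).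
exists psi; split.
- by rewrite n12.
- by move=> x xN; rewrite /psi (negPf (nK _ _ xN)).
- apply/setP=> z; apply/imsetP/idP => [[x xK ->]|].
    by rewrite /psi xK -i3 imset_f //; case: (invP x xK).
  rewrite -i3 => /imsetP[y yK ->].
  have : psi2 y \in psi1 @: K1 by rewrite i1 -i2 imset_f.
  case/imsetP=> x xK e; exists x; rewrite // /psi xK; have [ix ex] := invP x xK.
  by rewrite (inj2 (inv x) y) // ex.
- move=> x y xK yK; rewrite /psi xK yK; have [ix ex] := invP x xK; have [iy ey] := invP y yK.
  by move/inj3 => /(_ ix iy) e; apply: inj1 => //; rewrite -ex -ey e.
move=> x y xA yA; have [x2 x2A [ex ->]] := key x xA; have [y2 y2A [ey ->]] := key y yA.
have [g1 c1] := a1 x y xA yA; have [g2 c2] := a2 _ _ x2A y2A; have [g3 c3] := a3 _ _ x2A y2A.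
split; first by rewrite g3 -g2 ex ey g1.
move=> xy; have xy2 : (x2 == y2) || gadj x2 y2.
  case/orP: xy => [/eqP exy|xy]; last by rewrite -g2 ex ey g1 xy orbT.
  by rewrite (e2 x2 y2) ?eqxx // ex ey exy.
by rewrite -c3 // c2 // ex ey c1.
Qed.

Lemma card_piece_iso h K K' psi : piece_iso h K K' psi -> #|K| = #|K'|.
Proof. by case=> _ _ <- inj _; rewrite card_in_imset. Qed.

(** Use [h] off [D] and the chosen isomorphism on each component. Injectivity of [g] keeps
    components apart, and equal cardinality turns an injective map into a bijection. *)
Lemma glue_pieces (D : {set gV G}) (D' : {set gV G'}) (h : gV G -> gV G')
    (g : {set gV G} -> {set gV G'}) :
  #|gV G| = #|gV G'| ->
  {in ~: D &, injective h} -> (forall x, x \notin D -> h x \notin D') ->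
  (forall x y, x \notin D -> y \notin D -> gadj (h x) (h y) = gadj x y /\
     ((x == y) || gadj x y -> l x y = l' (h x) (h y))) ->
  {in component D @: D &, injective g} ->
  (forall x, x \in D -> g (component D x) \in component D' @: D' /\
     exists psi, piece_iso h (component D x) (g (component D x)) psi) ->
  exists phi, acol_iso l l' phi /\ forall x, x \notin D -> phi x = h x.
Proof.
move=> cV hinj hD ha ginj gP.
have [psi psiP] : exists psi : {set gV G} -> gV G -> gV G', forall K, K \in component D @: D ->
    piece_iso h K (g K) (psi K).
  apply: (@fin_all_exists _ (fun=> gV G -> gV G')
    (fun K p => K \in component D @: D -> piece_iso h K (g K) p)).
  move=> K; have [/imsetP[x xD ->]|KD] := boolP (K \in component D @: D); last by exists h.
  by have [_ [p pP]] := gP x xD; exists p.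
pose phi x := if x \in D then psi (component D x) x else h x.
have pP x : x \in D -> piece_iso h (component D x) (g (component D x)) (psi (component D x)).
  by move=> xD; apply/psiP/imset_f.
have phig x : x \in D -> phi x \in D' /\ g (component D x) = component D' (phi x).
  move=> xD; have [_ _ img _ _] := pP x xD.
  have px : phi x \in g (component D x).
    by rewrite /phi xD -img imset_f ?component_refl.
  have [/imsetP[w wD' ew] _] := gP x xD; rewrite ew in px.
  by split; [exact: (subsetP (component_sub wD')) | rewrite (component_eq px)].
have compinj x y : x \in D -> y \in D -> phi y \in component D' (phi x) ->
    component D y = component D x.
  move=> xD yD /component_eq; have [_ <-] := phig x xD; have [_ <-] := phig y yD.
  by move/ginj; apply; apply: imset_f.
have phiE x y : x \in D -> y \in component D x :|: nb (component D x) ->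
    phi y = psi (component D x) y.
  move=> xD /setUP[yx|yn].
    by rewrite /phi (component_eq yx) (subsetP (component_sub xD) _ yx).
  have := subsetP (nb_component xD) _ yn; rewrite inE => /negPf yD.
  by have [_ -> //] := pP x xD; rewrite /phi yD.
have phiDF x : (phi x \in D') = (x \in D).
  have [xD|xD] := boolP (x \in D); first by case: (phig x xD).
  by rewrite /phi (negPf xD); apply/negbTE/hD.
have key x y : x \in D -> gadj (phi x) (phi y) = gadj x y /\
    ((x == y) || gadj x y -> l x y = l' (phi x) (phi y) /\ l y x = l' (phi y) (phi x)).
  move=> xD; have [_ _ _ _ a] := pP x xD.
  have xA : x \in component D x :|: nb (component D x) by rewrite inE component_refl.
  have [yA|yA] := boolP (y \in component D x :|: nb (component D x)).
    have [gxy cxy] := a x y xA yA; have [_ cyx] := a y x yA xA.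
    rewrite !(phiE x) //; split=> // xy; split; first exact: cxy.
    by apply: cyx; rewrite eq_sym gadj_sym.
  move: yA; rewrite in_setU negb_or => /andP[yx yn].
  have xy : (x == y) || gadj x y = false.
    apply/negP=> /predU1P[e|xy]; first by rewrite -e component_refl in yx.
    by move: yn; rewrite (mem_nb (component_refl D x) xy yx).
  move: (xy) => /norP[_ nxy]; rewrite xy (negPf nxy); split=> //.
  (* An edge between the images would put [phi y] in the image component or among its attachments,
     and hence [y] in the component of [x] or among its attachments. *)
  apply/negP=> pxy; have [pxD eg] := phig x xD.
  have [yD|yD] := boolP (y \in D).
    have /(compinj x y xD yD) e : phi y \in component D' (phi x).
      by apply: component_adj (component_refl _ _) pxD _ pxy; rewrite phiDF.
    by rewrite -e component_refl in yx.
  have : phi y \in nb (component D' (phi x)).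
    apply: mem_nb (component_refl _ _) pxy _; apply/negP=> /(subsetP (component_sub pxD)).
    by rewrite phiDF (negPf yD).
  rewrite -eg; have [<- _ _ _ _] := pP x xD => /imsetP[z zn].
  have zD := subsetP (nb_component xD) _ zn; rewrite {1}/phi (negPf yD) => /hinj e.
  by rewrite e ?zn // in yn; rewrite inE.
have phi_inj : injective phi.
  move=> x y e; have := phiDF x; rewrite e phiDF.
  have [xD|xD] := boolP (x \in D) => yD; last first.
    by move: e; rewrite /phi yD (negPf xD) => /hinj; apply; rewrite inE ?xD ?yD.
  have [pyD _] := phig y yD.
  have exy : component D y = component D x.
    by apply: compinj => //; rewrite e component_refl.
  have [_ _ _ inj _] := pP x xD; apply: inj; rewrite ?component_refl // -?exy ?component_refl //.
  by move: e; rewrite /phi xD yD exy.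
have col x y : (x == y) || gadj x y -> l x y = l' (phi x) (phi y).
  have [xD|xD] := boolP (x \in D); first by case: (key x y xD) => _ + xy => /(_ xy)[].
  have [yD|yD] := boolP (y \in D).
    by rewrite eq_sym gadj_sym; case: (key y x yD) => _ + xy => /(_ xy)[].
  by rewrite /phi (negPf xD) (negPf yD); case: (ha x y xD yD).
exists phi; split; last by move=> x xD; rewrite /phi (negPf xD).
split.
- by apply: inj_card_bij; rewrite ?cV.
- move=> x y; have [xD|xD] := boolP (x \in D); first by case: (key x y xD).
  have [yD|yD] := boolP (y \in D).
    by rewrite gadj_sym [RHS]gadj_sym; case: (key y x yD).
  by rewrite /phi (negPf xD) (negPf yD); case: (ha x y xD yD).
- by move=> x; apply: col; rewrite eqxx.
by move=> x y xy; apply: col; rewrite xy orbT.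
Qed.

End Gluing.

(** * The inductive step: splitting off the ends *)

Section Step.
Variable k : nat.
Hypothesis k_ge3 : 2 < k.
Local Notation E3 := (@E3 k _ _).
Local Notation E2 := (@E2 k _ _).
Local Notation E1 := (@E1 k _ _).
Local Notation invariant := (invariant k).
Variable C : graph -> Prop.
Hypothesis C_minor : minor_closed C.

(** Only a root vertex is followed: a vertex inside an end may go elsewhere when pieces are matched
    by counting. *)
Definition identifies n := forall G G' : graph, C G -> C G' -> #|gV G| <= n ->
  forall (l : arc_coloring G) (l' : arc_coloring G') M M', root M -> invariant l l' M M' ->
  forall s s', E1 l l' s s' -> exists phi, acol_iso l l' phi /\ (s \in M -> phi s = s').

Variables (n : nat).
Hypothesis idn : identifies n.
Variables (G G' : graph).
Hypotheses (CG : C G) (CG' : C G') (Gn : #|gV G| <= n.+1).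
Variables (l : arc_coloring G) (l' : arc_coloring G') (kappa : nat).
Hypothesis kappa_le2 : kappa <= 2.
Hypothesis frag_kappa : forall A : {set gV G}, frag A -> kappa <= #|nb A|.
Hypothesis frag_kappa' : forall A : {set gV G'}, frag A -> kappa <= #|nb A|.
Variables (D : {set gV G}) (D' : {set gV G'}).
Hypothesis DD' : invariant l l' D D'.
Hypothesis pieceD : forall x, x \in D ->
  #|nb (component D x)| = kappa /\ co (component D x) != set0.
Hypothesis pieceD' : forall x, x \in D' ->
  #|nb (component D' x)| = kappa /\ co (component D' x) != set0.

Lemma piece_frag (H : graph) (B : {set gV H}) x : co (component B x) != set0 ->
  frag (component B x).
Proof. by rewrite /frag => ->; rewrite andbT; apply/set0Pn; exists x; apply: component_refl. Qed.

Lemma C_torso_piece (H : graph) (B : {set gV H}) x : C H ->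
  (forall A : {set gV H}, frag A -> kappa <= #|nb A|) ->
  #|nb (component B x)| = kappa -> co (component B x) != set0 ->
  C (torso (component B x :|: nb (component B x)) [set nb (component B x)]).
Proof.
move=> CH fk nk ck; apply: C_minor CH _; apply: torso_minor_piece; rewrite ?nk //.
exact: piece_frag.
Qed.

(** Induction on the torso of the piece, colored by pair classes with membership in the attachment
    set, and rooted at the virtual edge if there are two attachments. *)
Lemma linked_piece_iso (h : gV G -> gV G') w0 w0' (u : ktuple k G) (u' : ktuple k G') :
  w0 \in D -> w0' \in D' ->
  linked l l' (component D w0) (component D' w0') u u' ->
  (forall z, z \in nb (component D w0) -> exists i, u i = z /\ u' i = h z) ->
  exists psi, piece_iso l l' h (component D w0) (component D' w0') psi.
Proof.
move=> wD wD' lk hz; have [nK cK] := pieceD wD; have [nK' cK'] := pieceD' wD'.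
set K := component D w0 in lk hz nK cK *; set K' := component D' w0' in lk nK' cK' *.
have hN z : z \in nb K -> h z \in nb K'.
  by move=> zN; have [i [iz <-]] := hz z zN; case: (linked_mem k_ge3 DD' i lk) => _ <-; rewrite iz.
have hinj : {in nb K &, injective h}.
  move=> x y xN yN e; have [i [ei ix]] := hz x xN; have [j [ej jy]] := hz y yN.
  apply/eqP; rewrite -ei -ej; case: lk => /(stable_eq_eq i j)-> _; by rewrite ix jy e.
have hNN : h @: nb K = nb K'.
  apply/eqP; rewrite eqEcard card_in_imset // nK nK' leqnn andbT.
  by apply/subsetP=> _ /imsetP[z zN ->]; apply: hN.
have [mu [mu' muP]] := pair_coloring k l l' (nb K) (nb K').
have mem2 i : (u i \in K :|: nb K) = (u' i \in K' :|: nb K').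
  by rewrite !in_setU; have [-> ->] := linked_mem k_ge3 DD' i lk.
(* With two attachments, the pebble handed to the induction has to be a root vertex, so that its
   image is prescribed. *)
have [i [iA iN]] : exists i, u i \in K :|: nb K /\ (kappa = 2 -> u i \in nb K).
  case: lk => _ [j [jK jK']]; have [k2|nk2] := eqVneq kappa 2; last first.
    by exists j; split; [rewrite in_setU jK | move/eqP; rewrite (negPf nk2)].
  have [a aN] : exists a, a \in nb K by apply/card_gt0P; rewrite nK k2.
  by have [i [iz _]] := hz a aN; exists i; rewrite iz in_setU aN orbT.
have iA' : u' i \in K' :|: nb K' by rewrite -mem2.
pose Q := torso (K :|: nb K) [set nb K]; pose Q' := torso (K' :|: nb K') [set nb K'].
pose s : gV Q := Sub (u i) iA; pose s' : gV Q' := Sub (u' i) iA'.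
pose N := if kappa == 2 then [set v : gV Q | val v \in nb K] else set0.
pose N' := if kappa == 2 then [set v : gV Q' | val v \in nb K'] else set0.
have ss' : E1 (torso_col mu) (torso_col mu') s s'.
  apply/vcolor_E1; apply: (torso_piece_stable k_ge3 DD' _ _ lk) => //.
    by rewrite nK.
  by move=> x y x' y' e ex ey; apply/muP.
have rootN : root N.
  rewrite /N; case: eqP => [k2|_]; [right | by left].
  split; last first.
    move=> x y; rewrite [x \in _]in_set [y \in _]in_set => xN yN xy; rewrite /= augE (inj_eq val_inj) xy /=.
    apply/orP; right; apply/exists_inP; exists (nb K); first exact: set11.
    by apply/andP.
  rewrite -k2 -nK -(card_imset _ val_inj); apply: eq_card => z.
  apply/imsetP/idP => [[v + ->]|zN]; first by rewrite in_set.
  have zA : z \in K :|: nb K by rewrite in_setU zN orbT.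
  by exists (Sub z zA : gV Q) => //; rewrite in_set.
have NN' : invariant (torso_col mu) (torso_col mu') N N'.
  move=> x x' /(E3_atoms k_ge3)[_ _]; rewrite eqxx /= => /(_ isT)/muP[_ exx _].
  by rewrite /N /N'; case: eqP => _; rewrite ?in_set0 // [LHS]in_set [RHS]in_set.
have [CQ CQ'] : C Q /\ C Q' by split; apply: C_torso_piece.
have Qn : #|gV Q| <= n.
  rewrite card_torso -ltnS; apply: leq_trans Gn; rewrite -cardsT; apply: proper_card.
  rewrite properE subsetT; apply/subsetPn; case/set0Pn: cK => y; rewrite in_setC => yA.
  by exists y.
have [phi [phiP phis]] := idn CQ CQ' Qn rootN NN' ss'.
have [psi [psiE psiA psiinj psiadj psicol]] := torso_iso (u' i) phiP.
have psiN x : x \in K :|: nb K -> (x \in nb K) = (psi x \in nb K').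
  by move=> xA; have := psicol x x xA xA; rewrite eqxx => /(_ isT)/muP[].
have subN x : x \in nb K -> x \in K :|: nb K by move=> xN; rewrite in_setU xN orbT.
have nbK x : x \in nb K -> x \notin K by case/nbP.
have nbK' x : x \in nb K' -> x \notin K' by case/nbP.
(* With two attachments, one follows its pebble and injectivity forces the other. With at most one,
   membership in the attachment set, recorded by the colors, forces it. *)
have psih : {in nb K, psi =1 h}.
  move=> z zN; have pzN : psi z \in nb K' by rewrite -psiN ?subN.
  move: kappa_le2; rewrite leq_eqVlt => /predU1P[k2|].
    have psi_i : psi (u i) = u' i.
      rewrite -[u i]/(val s) psiE phis // /N k2 eqxx in_set; exact: iN.
    have uh : u' i = h (u i).
      have [j [ej <-]] := hz _ (iN k2); case: lk => /(stable_eq_eq i j) + _.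
      by rewrite ej eqxx => /esym/eqP.
    have [->|zi] := eqVneq z (u i); first by rewrite psi_i uh.
    have hzi : h z != h (u i) by apply: contra zi => /eqP/hinj-> //; exact: iN.
    have n2 : #|nb K'| <= 2 by rewrite nK' k2.
    have [//|e] := pair_cover n2 (hN _ zN) (hN _ (iN k2)) hzi pzN.
    have := psiinj z (u i) (subN _ zN) iA; rewrite e psi_i uh => /(_ erefl) ez.
    by rewrite ez eqxx in zi.
  rewrite ltnS => k1; have n1 : #|nb K'| <= 1 by rewrite nK'.
  exact: (card_le1_eqP n1 _ _ (hN _ zN) pzN).
exists psi; split=> //.
- have cKK : #|K| = #|K'|.
    have [f [bf _ fK]] := linked_step k_ge3 DD' lk.
    by apply: (card_bij_set bf) => x; case: (fK x).
  have inj : {in K &, injective psi}.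
    by move=> x y xK yK; apply: psiinj; rewrite in_setU ?xK ?yK.
  apply/eqP; rewrite eqEcard card_in_imset // cKK leqnn andbT.
  apply/subsetP=> _ /imsetP[x xK ->]; have xA : x \in K :|: nb K by rewrite in_setU xK.
  have := psiA x xA; rewrite in_setU -(psiN x xA) => /orP[//|/nbK].
  by rewrite xK.
- by move=> x y xK yK; apply: psiinj; rewrite in_setU ?xK ?yK.
move=> x y xA yA; have aug_gadj (H : graph) (F : {set {set gV H}}) a b : gadj a b -> aug F a b.
  by rewrite augE => ->.
have E2xy : (x == y) || gadj x y -> E2 l l' x y (psi x) (psi y).
  by move=> xy; have := psicol x y xA yA; case/orP: xy => [->|/aug_gadj->];
    rewrite ?orbT => /(_ isT)/muP[].
split; last by move=> xy; have [_ _ ->] := E3_atoms k_ge3 (E2xy xy).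
apply/idP/idP => [pxy|xy]; last first.
  by have := E2xy; rewrite xy orbT => /(_ isT)/(E3_atoms k_ge3)[_ <- _].
(* The pair [x], [y] is adjacent in the torso, perhaps virtually; its color is an [E2] class, which
   shows that the edge is real. *)
have := psiadj x y xA yA; rewrite (aug_gadj _ _ _ _ pxy) => /esym axy.
have := psicol x y xA yA; rewrite axy orbT => /(_ isT)/muP[/(E3_atoms k_ge3)[_ -> _]] //.
Qed.

(** Prepares to pebble all attachments at once: the virtual edge makes the class of an attachment
    pair part of what [h] preserves. *)
Lemma attachment_pair (h : gV G -> gV G') x s s' : x \in D -> E1 l l' s s' ->
  (forall y z, y \notin D -> z \notin D -> (y == z) || aug (attachments D) y z ->
     E2 l l' y z (h y) (h z)) ->
  exists p q p' q', E2 l l' p q p' q' /\ forall z, z \in nb (component D x) ->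
    z = p /\ h z = p' \/ z = q /\ h z = q'.
Proof.
move=> xD ss' hE; have [nx _] := pieceD xD.
have ND z : z \in nb (component D x) -> z \notin D.
  by move/(subsetP (nb_component xD)); rewrite inE.
have [N0|[a aN]] := set_0Vmem (nb (component D x)).
  by exists s, s, s', s'; split=> // z; rewrite N0 inE.
have [/existsP[b /andP[bN ba]]|/existsPn nob] :=
  boolP [exists b, (b \in nb (component D x)) && (b != a)].
  exists a, b, (h a), (h b); split.
    apply: hE; rewrite ?ND // augE; apply/orP; right; apply/orP; right.
    rewrite eq_sym ba; apply/exists_inP; exists (nb (component D x)); first exact: imset_f.
    by rewrite aN bN.
  move=> z zN; rewrite eq_sym in ba.
  have n2 : #|nb (component D x)| <= 2 by rewrite nx.
  by case: (pair_cover n2 aN bN ba zN) => ->; [left|right].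
exists a, a, (h a), (h a); split; first by apply: hE; rewrite ?eqxx ?ND.
by move=> z zN; left; have := nob z; rewrite zN negbK => /eqP->.
Qed.

(** Induction on the graph without [D], with the same root and colored by pair classes, which [h]
    then respects on vertices and on real and virtual edges. *)
Lemma torso_delete_iso M M' s s' : D != set0 -> root M -> invariant l l' M M' ->
  [disjoint M & D] -> E1 l l' s s' ->
  exists h : gV G -> gV G', [/\ {in ~: D &, injective h},
    forall x, x \notin D -> h x \notin D',
    forall y z, y \notin D -> z \notin D -> (y == z) || aug (attachments D) y z ->
      E2 l l' y z (h y) (h z),
    forall y z, y \notin D -> z \notin D ->
      aug (attachments D') (h y) (h z) = aug (attachments D) y z
    & s \in M -> h s = s'].
Proof.
move=> D0 rM MM' dM ss'; have [f [bf fs fP]] := E1_bij k_ge3 ss'.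
have [DT|[y0]] := set_0Vmem (~: D).
  have inD x : x \in D by have := in_set0 x; rewrite -DT inE => /negbFE.
  exists f; split=> [x y| x|x y|x y|//]; by rewrite ?inE inD.
rewrite inE => y0D.
(* The induction starts from an equivalent pair off [D]. If [s] is in [D], it is not a root vertex
   and any such pair serves. *)
have [s0 [s0' [s0D s0s0' s0M]]] : exists s0 s0', [/\ s0 \notin D, E1 l l' s0 s0'
    & s \in M -> s0 = s /\ s0' = s'].
  have [sD|sD] := boolP (s \in D); last by exists s, s'.
  exists y0, (f y0); split=> //; first by case: (fP y0).
  by move=> /(disjointFr dM); rewrite sD.
have [mu [mu' muP]] := pair_coloring k l l' set0 set0.
pose H := torso (~: D) (attachments D); pose H' := torso (~: D') (attachments D').
have tD : s0 \in ~: D by rewrite inE.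
have tD' : s0' \in ~: D' by rewrite inE -(DD' s0s0').
pose t : gV H := Sub s0 tD; pose t' : gV H' := Sub s0' tD'.
pose N := [set v : gV H | val v \in M]; pose N' := [set v : gV H' | val v \in M'].
have tt' : E1 (torso_col mu) (torso_col mu') t t'.
  apply/vcolor_E1; apply: (torso_delete_stable k_ge3 DD') => // x y x' y' e.
  by apply/muP; rewrite !in_set0.
have rootN : root N.
  case: rM => [M0|[M2 Madj]]; [left|right].
    by apply/setP=> v; rewrite /N M0 !inE.
  split; last first.
    move=> x y; rewrite !in_set => xM yM xy; rewrite /= augE; apply/orP; left.
    by apply: Madj => //; rewrite (inj_eq val_inj).
  rewrite -M2 -(card_imset _ val_inj); apply: eq_card => z.
  apply/imsetP/idP => [[v + ->]|zM]; first by rewrite in_set.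
  have zD : z \in ~: D by rewrite inE (disjointFr dM zM).
  by exists (Sub z zD : gV H) => //; rewrite in_set.
have NN' : invariant (torso_col mu) (torso_col mu') N N'.
  move=> x x' /(E3_atoms k_ge3)[_ _]; rewrite eqxx /= => /(_ isT)/muP[exx _ _].
  by rewrite [LHS]in_set [RHS]in_set; apply: MM'.
have CH : C H.
  by apply: C_minor CG _; apply: torso_minor_delete => x /pieceD[-> _].
have CH' : C H'.
  by apply: C_minor CG' _; apply: torso_minor_delete => x /pieceD'[-> _].
have Hn : #|gV H| <= n.
  rewrite card_torso -ltnS; apply: leq_trans Gn; rewrite -cardsT; apply: proper_card.
  rewrite properE subsetT; apply/subsetPn; case/set0Pn: D0 => y yD.
  by exists y; rewrite // inE yD.
have [phi [phiP phis]] := idn CH CH' Hn rootN NN' tt'.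
have [h [hE hA hinj hadj hcol]] := torso_iso s' phiP.
have DE x : x \notin D -> x \in ~: D by rewrite inE.
exists h; split=> [//|x /DE/hA|y z /DE yD /DE zD yz|y z /DE yD /DE zD|sM].
- by rewrite inE.
- by have /muP[] := hcol y z yD zD yz.
- exact: hadj.
have [es <-] := s0M sM; rewrite -es -[s0]/(val t) hE phis //.
by rewrite in_set -es in sM *.
Qed.

Lemma split_step M M' s s' : D != set0 -> root M -> invariant l l' M M' ->
  [disjoint M & D] -> E1 l l' s s' ->
  exists phi, acol_iso l l' phi /\ (s \in M -> phi s = s').
Proof.
move=> D0 rM MM' dM ss'.
have [h [hinj hD hE hadj hs]] := torso_delete_iso D0 rM MM' dM ss'.
have cV : #|gV G| = #|gV G'| by have [f [bf _ _]] := E1_bij k_ge3 ss'; apply: bij_eq_card bf.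
(* For each attachment set [N], pebble [N] and its [h]-image. The bijection [F N] of the next move
   sends a vertex of a component attached at [N] to one whose component is isomorphic over [h]. *)
have [F FP] : exists F : {set gV G} -> gV G -> gV G', forall N, N \in attachments D ->
    injective (F N) /\ forall x, x \in D -> nb (component D x) = N ->
      F N x \in D' /\ exists psi,
        piece_iso l l' h (component D x) (component D' (F N x)) psi.
  apply: (@fin_all_exists _ (fun=> gV G -> gV G') (fun N g => N \in attachments D ->
    injective g /\ forall x, x \in D -> nb (component D x) = N ->
      g x \in D' /\ exists psi, piece_iso l l' h (component D x) (component D' (g x)) psi)).
  move=> N; have [/imsetP[x0 x0D eN]|ND] := boolP (N \in attachments D); last by exists h.
  have [p [q [p' [q' [pq hpq]]]]] := attachment_pair x0D ss' hE.
  have [f [bf _ fP]] := E3_E4 k_ge3 pq; exists f => _; split; first exact: bij_inj.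
  move=> x xD ex; have [_ pqx _ _] := fP x; have [_ _ xx'] := E3_E1 k_ge3 pqx.
  have fxD : f x \in D' by rewrite -(DD' xx').
  split=> //; apply: (linked_piece_iso xD fxD (u := tr k p q x) (u' := tr k p' q' (f x))).
    by split=> //; exists (slot2 k_ge3); rewrite !tr2 !component_refl.
  move=> z; rewrite ex eN => /hpq[] [-> ->].
    by exists (slot0 k_ge3); rewrite !tr0.
  by exists (slot1 k_ge3); rewrite !tr1.
(* [Phi] serves to count the points of matching pieces; it need not be an isomorphism. *)
pose Phi x := if x \in D then F (nb (component D x)) x else h x.
have PhiP x : x \in D -> Phi x \in D' /\ exists psi,
    piece_iso l l' h (component D x) (component D' (Phi x)) psi.
  move=> xD; rewrite /Phi xD; have [_ FN] := FP _ (imset_f _ xD); exact: FN.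
have PhiD x : (x \in D) = (Phi x \in D').
  have [xD|xD] := boolP (x \in D); first by have [->] := PhiP x xD.
  by rewrite /Phi (negPf xD); apply/esym/negbTE/hD.
have nbD x : x \in D -> nb (component D x) \subset ~: D := @nb_component _ _ x.
have Phi_inj : injective Phi.
  move=> x y e; have := PhiD x; rewrite e -PhiD.
  have [xD|xD] := boolP (x \in D) => /esym yD; last first.
    by move: e; rewrite /Phi (negPf xD) yD => /hinj; apply; rewrite inE ?xD ?yD.
  have [_ [p [hp _ _ _ _]]] := PhiP x xD; have [_ [p2 [hp2 _ _ _ _]]] := PhiP y yD.
  (* Equal images lie in one component of [D'], so both attachment sets have the same [h]-image and
     coincide. Injectivity of a single [F N] then applies. *)
  have exy : nb (component D x) = nb (component D y).
    have im : h @: nb (component D x) = h @: nb (component D y) by rewrite hp hp2 e.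
    have sub u v : u \in D -> v \in D -> h @: nb (component D u) = h @: nb (component D v) ->
        nb (component D u) \subset nb (component D v).
      move=> uD vD euv; apply/subsetP=> z zu; have := imset_f h zu; rewrite euv.
      case/imsetP=> w wv /hinj-> //; [exact: (subsetP (nbD u uD))|exact: (subsetP (nbD v vD))].
    by apply/eqP; rewrite eqEsubset; apply/andP; split; apply: sub.
  have [Finj _] := FP _ (imset_f _ xD).
  by move: e; rewrite /Phi xD yD -exy => /Finj.
pose I K K' := nb K \subset ~: D /\ exists psi, piece_iso l l' h K K' psi.
have [] := @block_matching _ _ D D' (component D) (component D') I Phi.
- by move=> x xD; split; [apply: component_refl | apply: component_sub].
- by move=> x xD; split; [apply: component_refl | apply: component_sub].
- by move=> x y; apply: component_eq.
- by move=> x y; apply: component_eq.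
- move=> K1 K1' K2 K2' [n1 [p1 i1]] [n2 [p2 i2]] [_ [p3 i3]]; split=> //.
  exact: piece_iso_zigzag hinj n1 n2 i1 i2 i3.
- by move=> K K' [_ [p]]; apply: card_piece_iso.
- by apply: inj_card_bij; rewrite ?cV.
- exact: PhiD.
- by move=> x xD; split; [apply: nbD | case: (PhiP x xD)].
move=> g [ginj gP].
have [] := @glue_pieces _ _ l l' D D' h g cV hinj hD _ ginj.
- move=> x y xD yD.
  have eE : (x == y) || gadj x y -> E2 l l' x y (h x) (h y).
    by move=> xy; apply: hE => //; rewrite augE; case/orP: xy => ->; rewrite ?orbT.
  split; last by move=> xy; have [_ _ ->] := E3_atoms k_ge3 (eE xy).
  apply/idP/idP => [pxy|xy].
    have axy : aug (attachments D) x y by rewrite -hadj // augE pxy.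
    have := hE x y xD yD; rewrite axy orbT => /(_ isT)/(E3_atoms k_ge3)[_ -> _] //.
  by have := eE; rewrite xy orbT => /(_ isT)/(E3_atoms k_ge3)[_ <- _].
- move=> x xD; have [gK [_ gI]] := gP _ (imset_f (component D) xD); split=> //.
move=> phi [phiP phih]; exists phi; split=> // sM; rewrite phih ?hs //.
by rewrite (disjointFr dM sM).
Qed.

End Step.

(** * Cycles, small graphs and the induction *)

Section Base.
Variable k : nat.
Hypothesis k_ge3 : 2 < k.
Local Notation E3 := (@E3 k _ _).
Local Notation E2 := (@E2 k _ _).
Local Notation E1 := (@E1 k _ _).
Local Notation invariant := (invariant k).

Section Pair.
Variables (G G' : graph) (l : arc_coloring G) (l' : arc_coloring G').
Variables (s b : gV G) (s' b' : gV G').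
Hypothesis sb : E2 l l' s b s' b'.

Definition determined x := forall x1 x2,
  E3 l l' s b x s' b' x1 -> E3 l l' s b x s' b' x2 -> x1 = x2.

(** The bijection for the position [s], [b] is already the isomorphism: after pebbling [x], the
    reply to [y] is forced to be [f y], so every pair is equivalent to its image. *)
Lemma determined_iso : (forall x, determined x) ->
  exists phi, acol_iso l l' phi /\ phi s = s'.
Proof.
move=> det; have [f [bf [fs _ _] fP]] := E3_step k_ge3 sb; exists f; split=> //.
have fE x y : E2 l l' x y (f x) (f y).
  have [_ _ sbx] := fP x; have [_ _ sby] := fP y.
  have [g [_ _ /(_ y)[_ sby' sxy _]]] := E3_E4 k_ge3 sbx.
  rewrite (det y _ _ sby sby'); by case: (E3_E2 k_ge3 sxy).
split=> //.
- by move=> x y; case: (E3_atoms k_ge3 (fE x y)).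
- by move=> x; have [_ _ ->] := E3_atoms k_ge3 (fE x x); rewrite ?eqxx.
by move=> x y xy; have [_ _ ->] := E3_atoms k_ge3 (fE x y); rewrite ?xy ?orbT.
Qed.

Lemma determined_s : determined s.
Proof.
move=> x1 x2 /(E3_eqs k_ge3)[_ + _] /(E3_eqs k_ge3)[_ + _].
by rewrite eqxx => /esym/eqP<- /esym/eqP<-.
Qed.

Lemma determined_b : determined b.
Proof.
move=> x1 x2 /(E3_eqs k_ge3)[_ _ +] /(E3_eqs k_ge3)[_ _ +].
by rewrite eqxx => /esym/eqP<- /esym/eqP<-.
Qed.

(* On a cycle, the position of [s] and a neighbor fixes, step by step, the
   position of every vertex. *)
Lemma determined_cycle : gadj s b ->
  (forall x : gV G, #|nb [set x]| = 2) -> (forall x : gV G', #|nb [set x]| = 2) ->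
  (forall A : {set gV G}, frag A -> 2 <= #|nb A|) -> forall x, determined x.
Proof.
move=> adj_sb deg deg' fr.
(* The image of [z] is a neighbor of the image of [y] other than the image of [x]; degree 2 leaves
   just one. *)
have next x y z : determined x -> determined y -> gadj x y -> gadj y z -> x != z ->
    determined z.
  move=> dx dy xy yz xz z1 z2 sz1 sz2.
  have [f [_ _ fP]] := E3_E4 k_ge3 sz1; have [g [_ _ gP]] := E3_E4 k_ge3 sz2.
  have [_ fx sfx _] := fP x; have [_ fy sfy _] := fP y.
  have [_ gx sgx _] := gP x; have [_ gy sgy _] := gP y.
  rewrite -(dx _ _ fx gx) in sgx; rewrite -(dy _ _ fy gy) in sgy.
  have [h [_ _ /(_ x)[_ hx shx _]]] := E3_E4 k_ge3 fy.
  rewrite -(dx _ _ fx hx) in shx.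
  have [_ _ /(E3_atoms k_ge3)[_ xy' _] _] := E3_E2 k_ge3 shx.
  have [_ _ /(E3_atoms k_ge3)[_ zy1 _] _] := E3_E2 k_ge3 sfy.
  have [_ _ /(E3_atoms k_ge3)[_ zy2 _] _] := E3_E2 k_ge3 sgy.
  have [_ _ xz1] := E3_eqs k_ge3 sfx; have [_ _ xz2] := E3_eqs k_ge3 sgx.
  rewrite eq_sym in xz; rewrite (negPf xz) in xz1 xz2.
  have n2 : #|nb [set f y]| <= 2 by rewrite deg'.
  have xN : f x \in nb [set f y] by rewrite nb1E -xy' gadj_sym.
  have z1N : z1 \in nb [set f y] by rewrite nb1E gadj_sym -zy1 gadj_sym.
  have z2N : z2 \in nb [set f y] by rewrite nb1E gadj_sym -zy2 gadj_sym.
  have ne1 : f x != z1 by rewrite eq_sym -xz1.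
  have [e|//] := pair_cover n2 xN z1N ne1 z2N.
  by rewrite e eqxx in xz2.
(* [W] is closed under adjacency, hence everything: otherwise it would be a fragment without outer
   neighbors. *)
pose W := [set y | `[< determined y /\ exists2 x, determined x & gadj x y >]].
have Wcl y z : y \in W -> gadj y z -> z \in W.
  rewrite !inE => /asboolP[dy [x dx xy]] yz; apply/asboolP; split; last by exists y.
  by case: (eqVneq x z) => [<-//|xz]; apply: (next x y z).
have sW : s \in W.
  rewrite inE; apply/asboolP; split; first exact: determined_s.
  by exists b; [exact: determined_b | rewrite gadj_sym].
have nW : nb W = set0.
  apply/setP=> z; rewrite [RHS]inE; apply/negP=> /nbP[zW [y yW yz]].
  by rewrite (Wcl y z) in zW.
move=> x; suff : x \in W by rewrite inE => /asboolP[].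
apply: contraT => xW; have := fr W; rewrite nW cards0 => /(_ _); apply.
rewrite /frag; apply/andP; split; apply/set0Pn; first by exists s.
by exists x; rewrite /co nW setU0 inE.
Qed.

End Pair.

(** Pebbles on [s] and a second vertex leave at most one further vertex, whose image is then
    forced. *)
Lemma small_iso (G G' : graph) (l : arc_coloring G) (l' : arc_coloring G') s s' :
  #|gV G| <= 3 -> E1 l l' s s' -> exists phi, acol_iso l l' phi /\ phi s = s'.
Proof.
move=> G3 ss'; have [f [bf fs fP]] := E1_bij k_ge3 ss'.
have [/existsP[b bs]|/existsPn nob] := boolP [exists b, b != s]; last first.
  apply: (determined_iso ss') => x; have := nob x; rewrite negbK => /eqP->.
  exact: determined_s.
have [sb _] := fP b; apply: (determined_iso sb) => x.
case: (eqVneq x s) => [->|xs]; first exact: determined_s.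
case: (eqVneq x b) => [->|xb]; first exact: determined_b.
move=> x1 x2 /(E3_eqs k_ge3)[sb1 sx1 bx1] /(E3_eqs k_ge3)[_ sx2 bx2].
apply/eqP; apply: contraT => x12.
have u4 : uniq [:: x1; x2; s'; f b].
  have x1s : x1 != s' by rewrite eq_sym -sx1 eq_sym.
  have x2s : x2 != s' by rewrite eq_sym -sx2 eq_sym.
  have x1b : x1 != f b by rewrite eq_sym -bx1 eq_sym.
  have x2b : x2 != f b by rewrite eq_sym -bx2 eq_sym.
  have sb' : s' != f b by rewrite -sb1 eq_sym.
  by rewrite /= !inE !negb_or x12 x1s x2s x1b x2b sb'.
by have := max_card (mem [:: x1; x2; s'; f b]); rewrite (card_uniqP u4) -(bij_eq_card bf) leqNgt ltnS G3.
Qed.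

Lemma degree_E1 (G G' : graph) (l : arc_coloring G) (l' : arc_coloring G') x x' :
  E1 l l' x x' -> #|nb [set x]| = #|nb [set x']|.
Proof.
move=> xx'; have [f [bf _ fP]] := E1_bij k_ge3 xx'; apply: (card_bij_set bf) => y.
by rewrite !nb1E; have [/(E3_atoms k_ge3)[_ -> _] _] := fP y.
Qed.

Lemma kconnected3 (G : graph) : 3 < #|gV G| ->
  (forall A : {set gV G}, frag A -> 2 < #|nb A|) -> kconnected 3 G.
Proof.
move=> G3 fr; split=> // S S3 x y xS yS; apply: contraT => nxy.
have [|fK nK] := sep_frag xS yS; first by rewrite inE.
by have := leq_trans (fr _ fK) (subset_leq_card nK); rewrite leqNgt S3.
Qed.

Variable C : graph -> Prop.
Hypothesis C_minor : minor_closed C.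
Hypothesis C_orbits : determines_orbits k (fun G => C G /\ kconnected 3 G).

(** If [A] meets the root at [x], the other root vertex is adjacent to [x], so [co A] misses the
    root; and [co A] has no more outer neighbors than [A]. *)
Lemma frag_avoid (G : graph) kappa (M A : {set gV G}) : root M ->
  (forall B : {set gV G}, frag B -> kappa <= #|nb B|) -> frag A -> #|nb A| = kappa ->
  exists2 B : {set gV G}, frag B & #|nb B| = kappa /\ [disjoint B & M].
Proof.
move=> rM km fA nA; have [dA|] := boolP [disjoint A & M]; first by exists A.
case/pred0Pn=> x /andP[xA xM]; exists (co A); first exact: frag_co.
have {xA xM} [xA xM] : x \in A /\ x \in M by [].
split.
  apply/eqP; rewrite eqn_leq km ?frag_co // andbT -nA.
  exact/subset_leq_card/nb_co.
apply/pred0P=> y /=; apply/negP=> /andP[yA yM].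
case: rM => [M0|[_ adjM]]; first by move: xM; rewrite M0 inE.
have xy : x != y by apply: contraTneq yA => <-; apply/negP=> /coP[]; rewrite xA.
by have := co_adj xA yA; rewrite adjM.
Qed.

Lemma identifies_all n : identifies k C n.
Proof.
elim: n => [|n IH] G G' CG CG' Gn l l' M M' rM MM' s s' ss'.
  by move: Gn; rewrite leqn0 => /eqP/card0_eq/(_ s).
have weak : (exists phi, acol_iso l l' phi /\ phi s = s') ->
    exists phi, acol_iso l l' phi /\ (s \in M -> phi s = s').
  by case=> phi [? ?]; exists phi.
have [G3|G3] := leqP #|gV G| 3; first exact/weak/(small_iso G3 ss').
have [f [bf _ fP]] := E1_bij k_ge3 ss'; have cV := bij_eq_card bf.
have [/existsP[A0 /andP[fA0 nA0]]|/existsPn nofr] :=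
  boolP [exists A : {set gV G}, frag A && (#|nb A| <= 2)]; last first.
  have con : kconnected 3 G.
    by apply: kconnected3 => // A fA; have := nofr A; rewrite fA /= -ltnNge.
  have con' : kconnected 3 G'.
    apply: kconnected3; rewrite -?cV // => A fA; rewrite ltnNge; apply/negP=> nA.
    have [B fB nB] := frag_transfer k_ge3 (E3_sym ss') fA nA.
    by have := nofr B; rewrite fB (leq_trans nB nA).
  have [_ orb] := C_orbits (conj CG con) (conj CG' con') l l' s s'.
  apply: weak; exact/orb/vcolor_E1.
have [A fA minA] := arg_minnP (fun A : {set gV G} => #|nb A|) fA0.
set kappa := #|nb A| in minA *.
have k2 : kappa <= 2 := leq_trans (minA _ fA0) nA0.
have [B fB [nB dB]] := frag_avoid rM minA fA erefl.
have [m minE] := min_ends_ex minA fB nB dB.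
have minE' := min_ends_transfer k_ge3 k2 ss' MM' minE.
pose D := ends_union kappa m M; pose D' := ends_union kappa m M'.
have DD' : invariant l l' D D' := ends_union_inv k_ge3 k2 ss' MM' minE.
have rM' : root M'.
  have MfM x : (x \in M) = (f x \in M') by apply: MM'; case: (fP x).
  case: rM => [M0|[cM adjM]]; [left|right].
    apply/eqP; rewrite -cards_eq0 -(card_bij_set bf MfM) M0; exact/eqP/cards0.
  rewrite -(card_bij_set bf MfM); split=> // x' y' xM yM xy.
  have [g fK gK] := bf; have [_ exx] := fP (g x'); rewrite gK in exx.
  have [h [_ _ /(_ y')[e ey]]] := E1_bij k_ge3 (E3_sym exx).
  have [exy -> _] := E3_atoms k_ge3 e; apply: adjM; last by rewrite -exy.
    by rewrite (MM' _ _ exx).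
  by rewrite (MM' _ _ (E3_sym ey)).
have ends_dis (H : graph) (N : {set gV H}) : [disjoint N & ends_union kappa m N].
  rewrite disjoint_sym; apply/pred0P=> y /=; apply/negP=> /andP[/ends_unionP[K eK yK] yN].
  by case/and4P: eK => _ _ /disjointFr/(_ yK); rewrite yN.
have D0 : D != set0.
  case: (minE) => _ _ [K eK]; have [y yK] := set0Pn _ (end_neq0 eK).
  by apply/set0Pn; exists y; apply/ends_unionP; exists K.
have km : forall E : {set gV G}, frag E -> kappa <= #|nb E| by case: (minE).
have km' : forall E : {set gV G'}, frag E -> kappa <= #|nb E| by case: (minE').
suff : (exists phi, acol_iso l l' phi /\ (s \in M -> phi s = s')) \/
    (forall x, x \in D -> #|nb (component D x)| = kappa /\ co (component D x) != set0) /\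
    (forall x, x \in D' -> #|nb (component D' x)| = kappa /\ co (component D' x) != set0).
  case=> // -[pD pD'].
  exact: (split_step k_ge3 C_minor IH CG CG' Gn k2 km km' DD' pD pD' D0 rM MM' (ends_dis _ _) ss').
have [[kap2 m1]|nkm] := pselect (kappa = 2 /\ m = 1); last first.
  by right; split=> x xD; apply: end_piece nkm xD.
(* If all degrees are 2, the graph is a cycle. Otherwise [z] and its counterpart in [G'] make the
   path argument work on both sides. *)
have [/forallP deg2|/forallPn[z z2]] := boolP [forall x : gV G, #|nb [set x]| == 2].
  left; apply: weak; have deg (x : gV G) : #|nb [set x]| = 2 by apply/eqP; apply: deg2.
  have deg' (x : gV G') : #|nb [set x]| = 2.
    have [g _ gK] := bf; have [_ /degree_E1] := fP (g x); by rewrite gK deg.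
  have [b] : exists b, b \in nb [set s] by apply/card_gt0P; rewrite deg.
  rewrite nb1E => adj_sb; have [sb _] := fP b.
  apply: (determined_iso sb); apply: (determined_cycle adj_sb deg deg') => E /km.
  by rewrite kap2.
have [z' zz'] : exists z', E1 l l' z z' by exists (f z); case: (fP z).
right; split=> x xD.
  exact: (path_piece minE kap2 m1 G3 z2 xD).
apply: (path_piece minE' kap2 m1 _ _ xD (z := z')); first by rewrite -cV.
by rewrite -(degree_E1 zz').
Qed.

End Base.

Theorem theorem13 (C : graph -> Prop) (k : nat) :
  minor_closed C -> 3 <= k ->
  determines_orbits k (fun G => C G /\ kconnected 3 G) ->
  forall G G' : graph, C G -> C G' -> ~ graph_iso G G' -> distinguishes k G G'.
Proof.
move=> C_minor k_ge3 C_orbits G G' CG CG' niso [F [bF FP]]; apply: niso.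
have const0 (H : graph) (x : gV H) : tr k x x x (slot0 k_ge3) = x by rewrite tr0.
have [e|[s _]] := set_0Vmem [set: gV G].
  have noG (x : gV G) : False by have := in_setT x; rewrite e inE.
  have noG' (x : gV G') : False.
    by have [F' _ F'K] := bF; apply: noG (F' (tr k x x x) (slot0 k_ge3)).
  exists (fun x => False_rect _ (noG x)); split; last by move=> u; case: (noG u).
  by exists (fun x => False_rect _ (noG' x)) => x; [case: (noG x) | case: (noG' x)].
(* [F] sends the constant tuple at [s] to a tuple whose first entry is equivalent to [s]; the
   induction statement is then applied with an empty root. *)
have ss' := stable_eq_E3 k_ge3 (slot0 k_ge3) (slot0 k_ge3) (slot0 k_ge3) (FP (tr k s s s)).
have inv0 : invariant k (mono G) (mono G') set0 set0 by move=> x x' _; rewrite !inE.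
have [phi [[bphi phia _ _] _]] := identifies_all k_ge3 C_minor C_orbits CG CG' (leqnn _)
  (or_introl erefl) inv0 ss'.
by exists phi.
Qed.
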